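(* Let $V$ be a real-valued function on $\mathbb{R}^3$ which belongs to the Rollnik class, to $L^1(\mathbb{R}^3)$ and to $L^2(\mathbb{R}^3)$, and suppose $|V(r)|=O(|r|^{-3-\delta})$ as $|r|\to\infty$ for some $\delta>0$. Let $\lambda\in E_+$, let $\{G_j(\cdot,\lambda)\}_j$ be a complete orthonormal system in $L^2(S^2)$ of eigenfunctions of the unitary operator $S(\lambda)$, and let $\mu_j(\lambda)$ be the corresponding eigenvalues, $|\mu_j(\lambda)|=1$. Then the scattering amplitude satisfies $$f(\omega,\omega',\lambda)=\frac{2\pi}{i\sqrt{\lambda}}\sum_j(\mu_j(\lambda)-1)\,G_j(\omega,\lambda)\,\overline{G_j(\omega',\lambda)},$$ with convergence in $L^2(S^2\times S^2)$.
   Context: In $L^2(\mathbb{R}^3)$ let $\mathcal{L}_0=-\Delta$ and $\mathcal{L}=-\Delta+V$ (Schrödinger operators). The Rollnik class consists of measurable $V$ with $\iint |V(r)||V(s)||r-s|^{-2}\,dr\,ds<\infty$. For $\lambda>0$ let $W(s)=\mathrm{sgn}\,V(s)$ and $K(\lambda)f(r)=\frac1{4\pi}\int_{\mathbb{R}^3}|V(r)|^{1/2}\frac{e^{i\sqrt\lambda|r-s|}}{|r-s|}W(s)|V(s)|^{1/2}f(s)\,ds$ in $L^2(\mathbb{R}^3)$. $\lambda>0$ is exceptional if $[I+K(\lambda)]\psi=0$ has a nontrivial solution in $L^2(\mathbb{R}^3)$; $\mathcal{E}_+$ is the set of exceptional points and $E_+=(0,\infty)\setminus\mathcal{E}_+$.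 For $|k|^2=\lambda\in E_+$, $\phi(r,k)$ is the unique solution with $|V|^{1/2}\phi(\cdot,k)\in L^2(\mathbb{R}^3)$ of the Lippmann–Schwinger equation $\phi(r,k)=e^{ik\cdot r}-\frac1{4\pi}\int_{\mathbb{R}^3}\frac{e^{i|k||r-s|}}{|r-s|}V(s)\phi(s,k)\,ds$. The scattering amplitude is $f(\omega,\omega',\lambda)=-\frac1{4\pi}\int_{\mathbb{R}^3}e^{-i\sqrt\lambda\,s\cdot\omega}V(s)\phi(s,k)\,ds$ with $k=\sqrt\lambda\,\omega'$, $\omega,\omega'\in S^2$ (the unit sphere in $\mathbb{R}^3$ with standard measure $d\Omega$). $S(\lambda)$ is the scattering operator in the energy representation (the fibre at energy $\lambda$, acting on $L^2(S^2)$, of $S=W_+^*W_-$, $W_\pm=\text{s-}\lim_{t\to\pm\infty}e^{it\mathcal{L}}e^{-it\mathcal{L}_0}$). For $\lambda\in E_+$ it is unitary and is given (known facts) by $S(\lambda)=I-2\pi i\,T(\lambda)$, where $T(\lambda)=\mathcal{F}(\lambda)W[I+K(\lambda)]^{-1}\mathcal{F}^*(\lambda)$ is Hilbert–Schmidt, with $\mathcal{F}(\lambda):L^2(\mathbb{R}^3)\to L^2(S^2)$, $\mathcal{F}(\lambda)f(\omega)=\frac14\lambda^{1/4}\pi^{-3/2}\int_{\mathbb{R}^3}e^{-i\sqrt\lambda\,\omega\cdot r}|V(r)|^{1/2}f(r)\,dr$. *)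

(* Defs.v *)
From HB Require Import structures.
From mathcomp Require Import all_boot all_order all_algebra.
From mathcomp Require Import all_classical all_reals all_analysis.
From mathcomp Require Import measurable_realfun.
From mathcomp Require Import complex.

Set Implicit Arguments.
Unset Strict Implicit.
Unset Printing Implicit Defensive.

Import Order.TTheory GRing.Theory Num.Theory.
Import numFieldNormedType.Exports.

Local Open Scope classical_set_scope.
Local Open Scope ring_scope.

(* Fubini's theorem asks for canonically sigma-finite factors, which the library
   infers for products of subprobabilities only. *)
Lemma sigma_finite_product d1 d2 (T1 : measurableType d1)
    (T2 : measurableType d2) (R : realType)
    (m1 : {sigma_finite_measure set T1 -> \bar R})
    (m2 : {sigma_finite_measure set T2 -> \bar R}) :
  sigma_finite setT (m1 \x m2)%E.
Proof.
have /sigma_finiteP[F [TF ndF Foo]] := sigma_finiteT m1.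
have /sigma_finiteP[G [TG ndG Goo]] := sigma_finiteT m2.
exists (fun n => F n `*` G n).
  rewrite -setXTT TF TG predeqE => -[x y]; split.
    move=> [/= [n _ Fnx] [k _ Gky]]; exists (maxn n k) => //; split.
    - by move: x Fnx; exact/subsetPset/ndF/leq_maxl.
    - by move: y Gky; exact/subsetPset/ndG/leq_maxr.
  by move=> [n _ []/= ? ?]; split; exists n.
move=> k; have [? ?] := Foo k; have [? ?] := Goo k.
split; first exact: measurableX.
by rewrite product_measure1E// lte_mul_pinfty// ge0_fin_numE.
Qed.

Section euclidean_space.
Variable R : realType.

(* The Borel sigma-algebras on R^2 and R^3 are the product ones. *)
Definition R2 := (measurableTypeR R * measurableTypeR R)%type.
Definition R3 := (R2 * measurableTypeR R)%type.

Definition vec3 (x y z : R) : R3 := (x, y, z).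
Definition crd1 (r : R3) : R := r.1.1.
Definition crd2 (r : R3) : R := r.1.2.
Definition crd3 (r : R3) : R := r.2.

Definition dot3 (r s : R3) : R :=
  crd1 r * crd1 s + crd2 r * crd2 s + crd3 r * crd3 s.
Definition norm3 (r : R3) : R := Num.sqrt (dot3 r r).
Definition sub3 (r s : R3) : R3 :=
  vec3 (crd1 r - crd1 s) (crd2 r - crd2 s) (crd3 r - crd3 s).
Definition scale3 (a : R) (r : R3) : R3 :=
  vec3 (a * crd1 r) (a * crd2 r) (a * crd3 r).

Definition leb2 : set R2 -> \bar R :=
  (@lebesgue_measure R \x @lebesgue_measure R)%E.
HB.instance Definition _ := Measure.on leb2.
HB.instance Definition _ := Measure_isSigmaFinite.Build _ _ _ leb2
  (sigma_finite_product (@lebesgue_measure R) (@lebesgue_measure R)).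

Definition leb3 : set R3 -> \bar R := (leb2 \x @lebesgue_measure R)%E.
HB.instance Definition _ := Measure.on leb3.
HB.instance Definition _ := Measure_isSigmaFinite.Build _ _ _ leb3
  (sigma_finite_product leb2 (@lebesgue_measure R)).

Definition S2 : set R3 := [set r | norm3 r = 1].

(* Polar coordinates t = (theta, phi): theta is the polar angle and phi the
   azimuth. *)
Definition sph_coord (t : R2) : R3 :=
  vec3 (sin (t.1 : R) * cos (t.2 : R)) (sin (t.1 : R) * sin (t.2 : R))
       (cos (t.1 : R)).

Definition sph_angles : set R2 :=
  `[0 : R, pi]%classic `*` `[0 : R, 2 * pi]%classic.

(* Surface measure of S2, dOmega = sin theta dtheta dphi, as a Borel measure on
   R^3 carried by S2. *)
Definition dOmega (A : set R3) : \bar R :=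
  (\int[leb2]_(t in
     sph_angles `&` sph_coord @^-1` A) (sin (t.1 : R))%:E)%E.

Lemma measurable_sph_angles : measurable sph_angles.
Proof. by apply: measurableX; exact: measurable_itv. Qed.

Let measurable_coord1 (f : R -> R) : continuous f ->
  measurable_fun setT (fun t : R2 => f (t.1 : R)).
Proof.
move=> /continuous_measurable_fun mf _ Y mY; rewrite setTI.
have := @measurable_fst _ _ (measurableTypeR R) (measurableTypeR R).
move=> /(_ measurableT (f @^-1` Y)); rewrite setTI; apply.
by have := mf measurableT Y mY; rewrite setTI.
Qed.

Let measurable_coord2 (f : R -> R) : continuous f ->
  measurable_fun setT (fun t : R2 => f (t.2 : R)).
Proof.
move=> /continuous_measurable_fun mf _ Y mY; rewrite setTI.
have := @measurable_snd _ _ (measurableTypeR R) (measurableTypeR R).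
move=> /(_ measurableT (f @^-1` Y)); rewrite setTI; apply.
by have := mf measurableT Y mY; rewrite setTI.
Qed.

Let msin1 := measurable_coord1 (@continuous_sin R).
Let mcos1 := measurable_coord1 (@continuous_cos R).
Let msin2 := measurable_coord2 (@continuous_sin R).
Let mcos2 := measurable_coord2 (@continuous_cos R).

Lemma measurable_sph_coord : measurable_fun setT sph_coord.
Proof.
have toR (h : R2 -> R) : measurable_fun setT h ->
    measurable_fun setT (h : R2 -> measurableTypeR R).
    by move=> mh _ Y mY; exact: (mh measurableT Y mY).
apply: measurable_fun_pair; last exact: toR mcos1.
apply: measurable_fun_pair; apply: toR.
  exact: (measurable_funM msin1 mcos2).
exact: (measurable_funM msin1 msin2).
Qed.

Let sin1_ge0 (t : R2) :
  sph_angles t -> 0 <= sin (t.1 : R).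
Proof. by case=> /= t1 _; apply: sin_ge0_pi; rewrite in_itv in t1. Qed.

Let mpre A : measurable A -> measurable (sph_angles `&` sph_coord @^-1` A).
Proof.
move=> mA; apply: measurableI; first exact: measurable_sph_angles.
by rewrite -[X in measurable X]setTI; exact: measurable_sph_coord.
Qed.

Let dOmega0 : dOmega set0 = 0%E.
Proof. by rewrite /dOmega preimage_set0 setI0 integral_set0. Qed.

Let dOmega_ge0 A : (0 <= dOmega A)%E.
Proof. by apply: integral_ge0 => t [/sin1_ge0 ? _]; rewrite lee_fin. Qed.

Let dOmega_sigma_additive : semi_sigma_additive dOmega.
Proof.
move=> F mF tF mUF; rewrite /dOmega; apply: cvg_toP.
  apply: ereal_nondecreasing_is_cvgn => m n mn.
  by apply: lee_sum_nneg_natr => // k _ _; exact: dOmega_ge0.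
rewrite preimage_bigcup setI_bigcupr ge0_integral_bigcup//=.
- by move=> k; exact: mpre.
- apply: measurable_funTS; apply/measurable_EFinP; exact: msin1.
- by move=> t [k _] [/sin1_ge0 ? _]; rewrite lee_fin.
- apply/trivIsetP => i j _ _ ij.
  rewrite setIACA setIid -preimage_setI.
  by move/trivIsetP : tF => ->//; rewrite preimage_set0 setI0.
Qed.

HB.instance Definition _ := isMeasure.Build _ _ _ dOmega
  dOmega0 dOmega_ge0 dOmega_sigma_additive.

Let dOmega_finite : fin_num_fun dOmega.
Proof.
apply: lty_fin_num_fun; rewrite /= /dOmega.
rewrite (_ : _ `&` _ = sph_angles); last by apply/seteqP; split => t // [].
apply: (@le_lt_trans _ _
  (\int[leb2]_(t in sph_angles) 1)%E).
  apply: ge0_le_integral => //.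
  - exact: measurable_sph_angles.
  - apply: measurable_funTS; apply/measurable_EFinP; exact: msin1.
  - by move=> t _; rewrite lee_fin; exact: sin_le1.
rewrite integral_cst ?mul1e; last exact: measurable_sph_angles.
have mus : leb2 sph_angles = (@lebesgue_measure R `[0%R, pi] *
    @lebesgue_measure R `[0%R, (2 * pi)%R])%E.
  by apply: product_measure1E; exact: measurable_itv.
rewrite [ltLHS]mus.
rewrite !lebesgue_measure_itv /= !lte_fin.
by case: ifP => _; case: ifP => _; rewrite ?mul0e ?mule0 ?ltry// -EFinB -EFinM ltry.
Qed.

HB.instance Definition _ := Measure_isFinite.Build _ _ _ dOmega dOmega_finite.

End euclidean_space.

Section complex_L2.
Context (R : realType) (d : measure_display) (T : measurableType d).
Variables (mu : {measure set T -> \bar R}) (D : set T).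

Definition measurable_funC (f : T -> R[i]) :=
  measurable_fun D (fun x => complex.Re (f x)) /\
  measurable_fun D (fun x => complex.Im (f x)).

Definition integralC (f : T -> R[i]) : R[i] :=
  Complex (\int[mu]_(x in D) complex.Re (f x))
          (\int[mu]_(x in D) complex.Im (f x)).

(* square of the norm of f in L^2(D, mu) *)
Definition normsq2 (f : T -> R[i]) : \bar R :=
  (\int[mu]_(x in D) ((Normc.normc (f x)) ^+ 2)%:E)%E.

Definition L2 (f : T -> R[i]) := measurable_funC f /\ (normsq2 f < +oo)%E.

Definition inner2 (f g : T -> R[i]) : R[i] :=
  integralC (fun x => f x * (g x)^*%C).

Definition ae_eqC (f g : T -> R[i]) := {ae mu, forall x, D x -> f x = g x}.

Definition orthonormal (G : nat -> T -> R[i]) :=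
  (forall j, L2 (G j)) /\
  (forall i j, inner2 (G i) (G j) = (i == j)%:R).

Definition complete_orthonormal (G : nat -> T -> R[i]) :=
  orthonormal G /\
  (forall g, L2 g -> (forall j, inner2 g (G j) = 0) -> ae_eqC g (fun=> 0)).

End complex_L2.

Section scattering.
Variable R : realType.
Implicit Types (V : R3 R -> R) (l : R) (r s k w : R3 R).

Local Notation mu3 := (@leb3 R).
Local Notation sigma := (@dOmega R).
Local Notation L2R3 := (L2 mu3 setT).
Local Notation L2S2 := (L2 sigma (@S2 R)).

Definition cis (x : R) : R[i] := Complex (cos x) (sin x).

Definition rollnik V :=
  measurable_fun setT V /\
  (\int[mu3 \x mu3]_p
     (`|V p.1| * `|V p.2| * (norm3 (sub3 p.1 p.2) ^+ 2)^-1)%:E < +oo)%E.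

(* |V(r)| = O(|r|^a) as |r| -> oo *)
Definition bigO_at_infinity V (a : R) :=
  exists C rho : R, forall r, rho <= norm3 r -> `|V r| <= C * norm3 r `^ a.

Definition sqrtV V r : R := Num.sqrt `|V r|.

Definition mulW V (f : R3 R -> R[i]) : R3 R -> R[i] :=
  fun s => (Num.sg (V s))%:C%C * f s.

Definition opK V l (f : R3 R -> R[i]) : R3 R -> R[i] := fun r =>
  ((4 * pi)^-1)%:C%C *
  integralC mu3 setT (fun s =>
    (sqrtV V r)%:C%C
    * (cis (Num.sqrt l * norm3 (sub3 r s)) / (norm3 (sub3 r s))%:C%C)
    * (sqrtV V s)%:C%C * mulW V f s).

Definition exceptional V : set R := [set l | 0 < l /\
  exists psi, [/\ L2R3 psi, ~ ae_eqC mu3 setT psi (fun=> 0) &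
    ae_eqC mu3 setT (fun r => psi r + opK V l psi r) (fun=> 0)]].

Definition regular_energies V : set R := [set l | 0 < l] `\` exceptional V.

(* The integral converges absolutely for almost every r only, so that the
   equation is required almost everywhere. *)
Definition lippmann_schwinger V k (phi : R3 R -> R[i]) :=
  L2R3 (fun r => (sqrtV V r)%:C%C * phi r) /\
  ae_eqC mu3 setT phi (fun r =>
    cis (dot3 k r) -
    ((4 * pi)^-1)%:C%C *
    integralC mu3 setT (fun s =>
      cis (norm3 k * norm3 (sub3 r s)) / (norm3 (sub3 r s))%:C%C
      * (V s)%:C%C * phi s)).

(* phi r k is the value at r of the solution with wave vector k *)
Definition scattering_amplitude V (phi : R3 R -> R3 R -> R[i]) w w' l : R[i] :=
  - ((4 * pi)^-1)%:C%C *
  integralC mu3 setT (fun s =>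
    cis (- (Num.sqrt l * dot3 s w)) * (V s)%:C%C *
    phi s (scale3 (Num.sqrt l) w')).

Definition opF V l (f : R3 R -> R[i]) : R3 R -> R[i] := fun w =>
  (4^-1 * l `^ (4^-1) * pi `^ (- (3 / 2)))%:C%C *
  integralC mu3 setT (fun r =>
    cis (- (Num.sqrt l * dot3 w r)) * (sqrtV V r)%:C%C * f r).

(* The operators below are determined up to null sets, and are given by their
   graphs: "graph g h" reads "h is the image of g". *)

Definition opF_adj_graph V l (g u : R3 R -> R[i]) :=
  [/\ L2S2 g, L2R3 u &
    forall f, L2R3 f ->
      inner2 sigma (@S2 R) (opF V l f) g = inner2 mu3 setT f u].

(* psi = [I + K(l)]^-1 u *)
Definition inv_IK_graph V l (u psi : R3 R -> R[i]) :=
  [/\ L2R3 u, L2R3 psi &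
    ae_eqC mu3 setT (fun r => psi r + opK V l psi r) u].

(* T(l) = F(l) W [I + K(l)]^-1 F(l)^* *)
Definition opT_graph V l (g h : R3 R -> R[i]) :=
  exists u psi, [/\ opF_adj_graph V l g u, inv_IK_graph V l u psi &
    ae_eqC sigma (@S2 R) h (opF V l (mulW V psi))].

(* S(l) = I - 2 pi i T(l), the fibre at energy l of the scattering operator;
   this stationary representation pins the fibre down at every regular l,
   whereas the direct integral decomposition does so for almost every l. *)
Definition scattering_graph V l (g h : R3 R -> R[i]) :=
  exists2 t, opT_graph V l g t &
    ae_eqC sigma (@S2 R) h (fun w => g w - Complex 0 (2 * pi) * t w).

End scattering.

(* Main.v *)
Require Import Defs.
From mathcomp Require Import all_boot all_order all_algebra.
From mathcomp Require Import all_classical all_reals all_analysis.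
From mathcomp Require Import measurable_realfun.
From mathcomp Require Import complex ring lra.
Set Implicit Arguments.
Unset Strict Implicit.
Unset Printing Implicit Defensive.
Import Order.TTheory GRing.Theory Num.Theory.
Import numFieldNormedType.Exports.
Local Open Scope classical_set_scope.
Local Open Scope ring_scope.

(* With [A = |V|^(1/2)], [W = sgn V], [a_w = A e^(i sqrt(l) w.r)] and
   [psi_w = A phi(., sqrt(l) w)], the Lippmann-Schwinger equation reads
   [(I + K) psi_w = a_w] and the amplitude is, up to a constant,
   [f(w, w') = b(a_(-w), psi_w')] for the bilinear form [b(f, g) = int W f g].
   [K] is symmetric for [b], which yields the reciprocity relation
   [f(w, w') = b(psi_(-w), a_w')].  Hence [int f(w, w') G_j(w') dw'] is
   [b(psi_(-w), F^* G_j) = b(a_(-w), (I + K)^-1 F^* G_j)], a multiple of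
   [T G_j (w)], that is [(2 pi / (i sqrt l)) (mu_j - 1) G_j(w)]: these are the
   coefficients of [f(w, .)] in the complete orthonormal system of the conjugates
   of the [G_j].  Parseval's identity gives the expansion for almost every [w],
   and dominated convergence integrates it over [w].  Measurability of [f] and
   the domination come from [I + K] being bounded below, which makes [psi_w]
   bounded and continuous in [w].

   [I + K] is injective; it is bounded below because an orthonormal family on
   which it is at most 1/2 has bounded cardinality (Bessel's inequality for a
   Hilbert-Schmidt kernel), so that it is bounded below on the orthogonal of a
   finite family, whose members are then put back one at a time. *)

(** The solutions [phi(., k)] are given one wave vector at a time, with no regularity in [k], while
    [F^*] and [(I + K)^-1] are given by graphs, so solutions and inverse images come as data. What
    must be drawn from the regularity of the energy is quantitative: the lower bound turns
    [(I + K) psi_w = a_w] into estimates on the size of [psi_w] and on its variation with [w]. [F^*]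
    enters through its adjoint relation alone. The test function is [W] times the conjugate of
    [psi_(-w)]: by reciprocity, [F] maps it to a multiple of the conjugate of [f(w, .)], so the
    relation evaluates the integral of [f(w, .) G_j]. The pairing is bilinear because the kernel of
    [K] is complex: apart from [W] it is symmetric, not hermitian. Expanding in the second variable
    with the first one fixed uses completeness of the [G_j] on a single sphere. The constant arises
    from the two occurrences of [F] in [T]: if [c] is its prefactor, then [c^2 = sqrt l / (16 pi^3)]
    and [2 pi i * 4 pi c^2 = i sqrt l / (2 pi)], the inverse of [2 pi / (i sqrt l)]. *)

Local Notation Re := complex.Re.
Local Notation Im := complex.Im.

(** * Complex numbers *)

Section complex_lemmas.
Variable R : realType.
Implicit Types z w : R[i].

Lemma cReD z w : Re (z + w) = Re z + Re w. Proof. by case: z; case: w. Qed.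
Lemma cImD z w : Im (z + w) = Im z + Im w. Proof. by case: z; case: w. Qed.
Lemma cReN z : Re (- z) = - Re z. Proof. by case: z. Qed.
Lemma cImN z : Im (- z) = - Im z. Proof. by case: z. Qed.
Lemma cReM z w : Re (z * w) = Re z * Re w - Im z * Im w.
Proof. by case: z; case: w. Qed.
Lemma cImM z w : Im (z * w) = Re z * Im w + Im z * Re w.
Proof. by case: z; case: w. Qed.
Lemma cReJ z : Re z^*%C = Re z. Proof. by case: z. Qed.
Lemma cImJ z : Im z^*%C = - Im z. Proof. by case: z. Qed.

Lemma complexP z w : Re z = Re w -> Im z = Im w -> z = w.
Proof. by case: z => a b; case: w => c d /= -> ->. Qed.

Lemma conjcM z w : (z * w)^*%C = z^*%C * w^*%C. Proof. exact: rmorphM. Qed.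
Lemma conjcD z w : (z + w)^*%C = z^*%C + w^*%C. Proof. exact: rmorphD. Qed.
Lemma conjcN z : (- z)^*%C = - z^*%C. Proof. exact: rmorphN. Qed.

Lemma sqr_normcE z : Normc.normc z ^+ 2 = Re z ^+ 2 + Im z ^+ 2.
Proof. by case: z => a b /=; rewrite sqr_sqrtr// addr_ge0// sqr_ge0. Qed.

Lemma normc_ge0 z : 0 <= Normc.normc z.
Proof. by case: z => a b; exact: sqrtr_ge0. Qed.

Lemma mulcJ z : z * z^*%C = (Normc.normc z ^+ 2)%:C%C.
Proof.
by rewrite sqr_normcE; case: z => a b; apply: complexP => /=; ring.
Qed.

Lemma normcJE z : Normc.normc z^*%C = Normc.normc z.
Proof. by case: z => a b /=; rewrite sqrrN. Qed.

Lemma normc_real (x : R) : Normc.normc x%:C%C = `|x|.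
Proof. by rewrite /= expr0n/= addr0 sqrtr_sqr. Qed.

Lemma ler_Re_normc z : `|Re z| <= Normc.normc z.
Proof.
rewrite -(@ler_pXn2r _ 2)// ?nnegrE ?normc_ge0// sqr_normcE real_normK ?num_real//.
by rewrite lerDl sqr_ge0.
Qed.

Lemma ler_Im_normc z : `|Im z| <= Normc.normc z.
Proof.
rewrite -(@ler_pXn2r _ 2)// ?nnegrE ?normc_ge0// sqr_normcE real_normK ?num_real//.
by rewrite lerDr sqr_ge0.
Qed.

End complex_lemmas.

(** * Hilbert spaces *)

(* A complete semi-inner product space: [ip] is only required to be semidefinite,
   and only on [hdom], so that square integrable functions qualify without a
   quotient by almost everywhere equality. *)
Record hilbert (R : realType) (E : lmodType R[i]) := Hilbert {
  hdom : set E;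
  ip : E -> E -> R[i];
  hdom0 : hdom 0;
  hdomP : forall a f g, hdom f -> hdom g -> hdom (a *: f + g);
  ipPl : forall a f g h, hdom f -> hdom g -> hdom h ->
    ip (a *: f + g) h = a * ip f h + ip g h;
  ipC : forall f g, hdom f -> hdom g -> ip g f = (ip f g)^*%C;
  ip_ge0 : forall f, hdom f -> 0 <= ip f f;
  hcomplete : forall u : nat -> E, (forall n, hdom (u n)) ->
    (forall eps : R, 0 < eps -> exists N, forall m n, (N <= m)%N -> (N <= n)%N ->
        Re (ip (u m - u n) (u m - u n)) <= eps) ->
    exists2 g, hdom g &
      forall eps : R, 0 < eps -> exists N, forall n, (N <= n)%N ->
        Re (ip (u n - g) (u n - g)) <= eps }.

Section hilbert_theory.
Context (R : realType) (E : lmodType R[i]) (H : hilbert E).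
Local Notation dom := (hdom H).
Local Notation "<| f , g |>" := (ip H f g) (format "<| f ,  g |>").
Implicit Types f g h : E.

Lemma hdomD f g : dom f -> dom g -> dom (f + g).
Proof. by move=> Hf Hg; rewrite -[f]scale1r; exact: hdomP. Qed.

Lemma hdomZ a f : dom f -> dom (a *: f).
Proof. by move=> Hf; rewrite -[_ *: _]addr0; apply: hdomP => //; exact: hdom0. Qed.

Lemma hdomN f : dom f -> dom (- f).
Proof. by move=> Hf; rewrite -scaleN1r; exact: hdomZ. Qed.

Lemma hdomB f g : dom f -> dom g -> dom (f - g).
Proof. by move=> Hf Hg; apply: hdomD => //; exact: hdomN. Qed.

Lemma hdom_sum n (F : nat -> E) : (forall i, (i < n)%N -> dom (F i)) ->
  dom (\sum_(i < n) F i).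
Proof. by move=> HF; elim/big_ind: _ => [||i _]; [exact: hdom0|exact: hdomD|exact: HF]. Qed.

#[local] Hint Resolve hdomD hdomZ hdomN hdomB hdom0 hdom_sum : hd.
Local Ltac hd := by auto 10 with hd.

Lemma ipDl f g h : dom f -> dom g -> dom h -> <|f + g, h|> = <|f, h|> + <|g, h|>.
Proof. by move=> Hf Hg Hh; rewrite -{1}[f]scale1r ipPl// mul1r. Qed.

Lemma ip0l h : dom h -> <|0, h|> = 0.
Proof.
move=> Hh; have := ipDl (hdom0 H) (hdom0 H) Hh; rewrite addr0.
by move/eqP; rewrite -subr_eq subrr => /eqP.
Qed.

Lemma ipZl a f h : dom f -> dom h -> <|a *: f, h|> = a * <|f, h|>.
Proof. by move=> Hf Hh; rewrite -[a *: f]addr0 ipPl ?ip0l ?addr0//; hd. Qed.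

Lemma ipNl f h : dom f -> dom h -> <|- f, h|> = - <|f, h|>.
Proof. by move=> Hf Hh; rewrite -scaleN1r ipZl// mulN1r. Qed.

Lemma ipBl f g h : dom f -> dom g -> dom h -> <|f - g, h|> = <|f, h|> - <|g, h|>.
Proof. by move=> Hf Hg Hh; rewrite ipDl ?ipNl//; hd. Qed.

Lemma ip_suml n (F : nat -> E) h : (forall i, (i < n)%N -> dom (F i)) -> dom h ->
  <|\sum_(i < n) F i, h|> = \sum_(i < n) <|F i, h|>.
Proof.
move=> HF Hh; elim: n HF => [|n IH] HF; first by rewrite !big_ord0 ip0l.
rewrite !big_ord_recr/= ipDl//; [|by apply: hdom_sum => i /ltnW; exact: HF|exact: HF].
by rewrite IH// => i /ltnW; exact: HF.
Qed.

Lemma ipDr f g h : dom f -> dom g -> dom h -> <|h, f + g|> = <|h, f|> + <|h, g|>.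
Proof.
move=> Hf Hg Hh; rewrite (ipC (hdomD Hf Hg) Hh) ipDl// conjcD.
by rewrite -!ipC.
Qed.

Lemma ipZr a f h : dom f -> dom h -> <|h, a *: f|> = a^*%C * <|h, f|>.
Proof. by move=> Hf Hh; rewrite (ipC (hdomZ a Hf) Hh) ipZl// conjcM -ipC. Qed.

Lemma ipNr f h : dom f -> dom h -> <|h, - f|> = - <|h, f|>.
Proof. by move=> Hf Hh; rewrite (ipC (hdomN Hf) Hh) ipNl// conjcN -ipC. Qed.

Definition hsq f : R := Re (<|f, f|>).

Lemma ip_hsq f : dom f -> <|f, f|> = (hsq f)%:C%C.
Proof. by move=> Hf; apply: complexP => //=; apply: ger0_Im; exact: ip_ge0. Qed.

Lemma hsq_ge0 f : dom f -> 0 <= hsq f.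
Proof. by move=> Hf; rewrite -ler0c -ip_hsq// ip_ge0. Qed.

Lemma hsqD f g : dom f -> dom g ->
  hsq (f + g) = hsq f + hsq g + 2 * Re (<|f, g|>).
Proof.
move=> Hf Hg; rewrite /hsq ipDl ?ipDr//; last hd.
by rewrite [<|g, f|>](@ipC _ _ H f g)// !cReD cReJ; ring.
Qed.

Lemma hsqN f : dom f -> hsq (- f) = hsq f.
Proof. by move=> Hf; rewrite /hsq ipNl ?ipNr ?opprK//; hd. Qed.

Lemma hsqZ a f : dom f -> hsq (a *: f) = Normc.normc a ^+ 2 * hsq f.
Proof.
move=> Hf; rewrite /hsq ipZl ?ipZr//; last hd.
by rewrite mulrA mulcJ cReM/= mul0r subr0.
Qed.

Lemma hsqB f g : dom f -> dom g ->
  hsq (f - g) = hsq f + hsq g - 2 * Re (<|f, g|>).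
Proof.
by move=> Hf Hg; rewrite hsqD ?ipNr// ?hsqN// ?cReN; [ring|hd].
Qed.

Lemma hsq_subC f g : dom f -> dom g -> hsq (f - g) = hsq (g - f).
Proof. by move=> Hf Hg; rewrite -opprB hsqN//; hd. Qed.

(** The square of [f - t c g], with [c = <|f, g|>] and [t] real, is a nonnegative polynomial of
    degree at most two in [t]. *)
Lemma cauchy_schwarz f g : dom f -> dom g ->
  Normc.normc (<|f, g|>) ^+ 2 <= hsq f * hsq g.
Proof.
move=> Hf Hg; set c := <|f, g|>; set n := Normc.normc c ^+ 2.
have n0 : 0 <= n by rewrite sqr_ge0.
have key (t : R) : 0 <= hsq f - 2 * t * n + t ^+ 2 * n * hsq g.
  have := hsq_ge0 (hdomB Hf (hdomZ (t%:C%C * c) Hg)).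
  rewrite hsqB//; last hd.
  rewrite ipZr// hsqZ// conjcM -/c conjc_real -mulrA [c^*%C * c]mulrC mulcJ -/n.
  rewrite Normc.normcM exprMn -/n normc_real real_normK ?num_real//.
  by rewrite cReM/= mul0r subr0; nra.
have f0 := hsq_ge0 Hf; have g0 := hsq_ge0 Hg.
have [gz|gz] := eqVneq (hsq g) 0.
  (* A vector of zero square need not be zero, so this case is not trivial. The polynomial is then
     affine in [t], and at the chosen [t] it would equal -1. *)
  rewrite gz mulr0 leNgt; apply/negP => n1.
  have := key ((hsq f + 1) / (2 * n)).
  have -> : 2 * ((hsq f + 1) / (2 * n)) * n = hsq f + 1.
    by field; rewrite gt_eqF.
  by rewrite gz mulr0 addr0; lra.
have g1 : 0 < hsq g by rewrite lt_neqAle eq_sym gz.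
have := key (hsq g)^-1.
have -> : (hsq g)^-1 ^+ 2 * n * hsq g = n / hsq g by field.
have -> : 2 * (hsq g)^-1 * n = 2 * (n / hsq g) by ring.
by move=> h; rewrite -ler_pdivrMr//; lra.
Qed.

Definition hnorm f : R := Num.sqrt (hsq f).

Lemma hnorm_ge0 f : 0 <= hnorm f. Proof. exact: sqrtr_ge0. Qed.

Lemma sqr_hnorm f : dom f -> hnorm f ^+ 2 = hsq f.
Proof. by move=> Hf; rewrite sqr_sqrtr// hsq_ge0. Qed.

Lemma hnormN f : dom f -> hnorm (- f) = hnorm f.
Proof. by move=> Hf; rewrite /hnorm hsqN. Qed.

Lemma hnormZ a f : dom f -> hnorm (a *: f) = Normc.normc a * hnorm f.
Proof.
move=> Hf; rewrite /hnorm hsqZ// sqrtrM ?sqr_ge0// sqrtr_sqr ger0_norm//.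
exact: normc_ge0.
Qed.

Lemma cauchy_schwarz_hnorm f g : dom f -> dom g ->
  Normc.normc (<|f, g|>) <= hnorm f * hnorm g.
Proof.
move=> Hf Hg; rewrite -(@ler_pXn2r _ 2)// ?nnegrE ?normc_ge0 ?mulr_ge0 ?hnorm_ge0//.
by rewrite exprMn !sqr_hnorm//; exact: cauchy_schwarz.
Qed.

Lemma ler_hnormD f g : dom f -> dom g -> hnorm (f + g) <= hnorm f + hnorm g.
Proof.
move=> Hf Hg; rewrite -(@ler_pXn2r _ 2)// ?nnegrE ?addr_ge0 ?hnorm_ge0//.
rewrite sqr_hnorm; last hd.
rewrite hsqD// sqrrD !sqr_hnorm//.
have := le_trans (ler_norm _)
  (le_trans (ler_Re_normc (<|f, g|>)) (cauchy_schwarz_hnorm Hf Hg)).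
by rewrite mulr2n; lra.
Qed.

Lemma ler_hnormB f g : dom f -> dom g -> hnorm (f - g) <= hnorm f + hnorm g.
Proof. by move=> Hf Hg; rewrite -(hnormN Hg) ler_hnormD//; hd. Qed.

Definition orthonormal_upto (e : nat -> E) n :=
  (forall i, (i < n)%N -> dom (e i)) /\
  (forall i j, (i < n)%N -> (j < n)%N -> <|e i, e j|> = (i == j)%:R).

Definition proj (e : nat -> E) n f := \sum_(i < n) <|f, e i|> *: e i.

Lemma hdom_proj e n f : orthonormal_upto e n -> dom (proj e n f).
Proof. by move=> [He _]; apply: (hdom_sum (F := fun i => <|f, e i|> *: e i)) => i /He; hd. Qed.
#[local] Hint Resolve hdom_proj : hd.

Lemma ip_proj e n f j : orthonormal_upto e n -> (j < n)%N ->
  <|proj e n f, e j|> = <|f, e j|>.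
Proof.
move=> [He Ho] jn; rewrite /proj (ip_suml (F := fun i => <|f, e i|> *: e i)); last exact: He.
  rewrite (bigD1 (Ordinal jn))//= big1 ?addr0 => [|i ij].
    by rewrite ipZl ?Ho ?eqxx ?mulr1//; exact: He.
  rewrite ipZl ?Ho//; [|exact: He|exact: He].
  by rewrite (_ : (i == j :> nat) = false) ?mulr0//; apply/negbTE.
by move=> i /He; hd.
Qed.

Lemma ip_residual e n f j : orthonormal_upto e n -> dom f -> (j < n)%N ->
  <|f - proj e n f, e j|> = 0.
Proof.
move=> He Hf jn; rewrite ipBl ?ip_proj ?subrr//; first hd.
by case: He => He _; exact: He.
Qed.

Lemma ip_residual_span e n f (c : nat -> R[i]) : orthonormal_upto e n -> dom f ->
  <|f - proj e n f, \sum_(i < n) c i *: e i|> = 0.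
Proof.
move=> He Hf; have [De _] := He.
have Ds : dom (\sum_(i < n) c i *: e i).
  by apply: (hdom_sum (F := fun i => c i *: e i)) => i /De; hd.
rewrite (ipC Ds); last hd.
rewrite (ip_suml (F := fun i => c i *: e i)); [|by move=> i /De; hd|hd].
rewrite big1 ?conjc0// => i _.
have Di : dom (e i) by exact: De.
rewrite ipZl//; last hd.
rewrite (@ipC _ _ H (f - proj e n f) (e i))//; last hd.
by rewrite ip_residual// conjc0 mulr0.
Qed.

Lemma hsq_residual e n f : orthonormal_upto e n -> dom f ->
  hsq (f - proj e n f) = hsq f - \sum_(i < n) Normc.normc (<|f, e i|>) ^+ 2.
Proof.
move=> He Hf; have [De _] := He.
have Dp := hdom_proj f He.
have e1 : <|f, proj e n f|> = (\sum_(i < n) Normc.normc (<|f, e i|>) ^+ 2)%:C%C.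
  rewrite (@ipC _ _ H (proj e n f) f)//.
  rewrite /proj (ip_suml (F := fun i => <|f, e i|> *: e i))//; last by move=> i /De; hd.
  rewrite rmorph_sum/= rmorph_sum/=; apply: eq_bigr => i _.
  have Di : dom (e i) by exact: De.
  rewrite ipZl// conjcM -(@ipC _ _ H (e i) f)// mulrC.
  exact: mulcJ.
have e2 : <|proj e n f, proj e n f|> = <|f, proj e n f|>.
  apply/eqP; rewrite eq_sym -subr_eq0 -ipBl//.
  exact/eqP/(ip_residual_span (fun i => <|f, e i|>) He Hf).
by rewrite hsqB// /hsq e2 e1/=; ring.
Qed.

Lemma bessel e n f : orthonormal_upto e n -> dom f ->
  \sum_(i < n) Normc.normc (<|f, e i|>) ^+ 2 <= hsq f.
Proof.
move=> He Hf; rewrite -subr_ge0 -hsq_residual// hsq_ge0//; hd.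
Qed.

(** * Parseval's identity in a complete semi-inner product space *)

Section parseval.
Variable e : nat -> E.
Hypothesis e_on : forall n, orthonormal_upto e n.
Hypothesis e_total :
  forall g, dom g -> (forall j, <|g, e j|> = 0) -> hsq g = 0.

(** Pythagoras: the two residuals differ by a combination of [e m, ..., e (n - 1)], and this is
    orthogonal to the residual of rank [n]. *)
Lemma residual_step f m n : dom f -> (m <= n)%N ->
  hsq ((f - proj e m f) - (f - proj e n f)) =
  hsq (f - proj e m f) - hsq (f - proj e n f).
Proof.
move=> Hf mn; set r := f - proj e n f; set d := _ - r.
have Dr : dom r by rewrite /r; have := hdom_proj f (e_on n); hd.
have Dd : dom d by rewrite /d; have := hdom_proj f (e_on m); hd.
have -> : f - proj e m f = r + d by rewrite /d [RHS]addrC subrK.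
rewrite hsqD//; suff -> : <|r, d|> = 0 by rewrite mulr0; ring.
have -> : d = \sum_(i < n) (if (i < m)%N then 0 else <|f, e i|>) *: e i.
  rewrite /d /r opprB [LHS]addrC addrA subrK.
  have -> : proj e m f = \sum_(i < n) (if (i < m)%N then <|f, e i|> *: e i else 0).
    by rewrite -big_mkcond/= -(big_ord_widen _ (fun i => <|f, e i|> *: e i) mn).
  rewrite /proj -sumrB; apply: eq_bigr => i _.
  by case: ifP => _; rewrite ?scale0r ?subrr ?subr0.
by rewrite (ip_residual_span (fun i => if (i < m)%N then 0 else <|f, e i|>)).
Qed.

(** The squares of the residuals decrease, hence converge, and [residual_step] turns this into the
    Cauchy property of the residuals themselves. Their limit is orthogonal to every [e j], so it has
    zero square by totality. *)
Lemma parseval f : dom f -> (fun n => hsq (f - proj e n f)) @ \oo --> (0 : R).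
Proof.
move=> Hf; pose r n := f - proj e n f.
have Dr n : dom (r n) by rewrite /r; have := hdom_proj f (e_on n); hd.
have dec : {homo (fun n => hsq (r n)) : m n / (m <= n)%N >-> n <= m}.
  by move=> m n mn; rewrite -subr_ge0 -residual_step// hsq_ge0//; hd.
have lb : has_lbound (range (fun n => hsq (r n))).
  by exists 0 => _ [n _ <-]; exact: hsq_ge0.
have cv := nonincreasing_is_cvgn dec lb.
have cau (eps : R) : 0 < eps -> exists N, forall m n, (N <= m)%N -> (N <= n)%N ->
    Re (<|r m - r n, r m - r n|>) <= eps.
  move=> eps0; have /cvgrPdist_le/(_ _ eps0)[N _ hN] := cv.
  exists N => m n Nm Nn.
  have wl a b : (N <= a)%N -> (a <= b)%N -> hsq (r a - r b) <= eps.
    move=> Na ab; rewrite residual_step//.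
    have := hN _ Na; have := nonincreasing_cvgn_ge dec cv b.
    by rewrite distrC ler_norml => h1 /andP[_]; rewrite -/(r a) -/(r b); move: h1 => /=; lra.
  rewrite -/(hsq _); case: (leqP m n) => [|/ltnW] h; first exact: wl.
  by rewrite hsq_subC//; exact: wl.
have [g Dg hg] := hcomplete (u := r) Dr cau.
have g0 : hsq g = 0.
  apply: e_total => // j; have Dj : dom (e j) by have [+ _] := e_on j.+1; exact.
  have ej1 : hsq (e j) = 1.
    by have [_ +] := e_on j.+1 => /(_ j j); rewrite ltnSn eqxx /hsq => ->.
  (* From rank [j + 1] on, the residual is orthogonal to [e j], so that only its distance to [g]
     contributes. *)
  have small (eps : R) : 0 < eps -> Normc.normc (<|g, e j|>) ^+ 2 <= eps.
    move=> eps0; have [N hN] := hg _ eps0.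
    have := hN (maxn N j.+1) (leq_maxl _ _); rewrite -/(hsq _).
    apply: le_trans.
    have -> : <|g, e j|> = <|g - r (maxn N j.+1), e j|>.
      by rewrite ipBl// ip_residual ?subr0// leq_maxr.
    rewrite hsq_subC//; have := cauchy_schwarz (hdomB Dg (Dr (maxn N j.+1))) Dj.
    by rewrite ej1 mulr1.
  apply: Normc.eq0_normc; apply/eqP; rewrite -sqrf_eq0 eq_le sqr_ge0 andbT.
  by apply/ler_addgt0Pr => eps eps0; rewrite add0r; exact: small.
apply/cvgrPdist_le => eps eps0.
have [N hN] := hg _ eps0; exists N => // n /= Nn; rewrite sub0r normrN.
rewrite ger0_norm ?hsq_ge0//; last exact: Dr.
apply: le_trans (hN _ Nn); rewrite -/(hsq _) -/(r n) hsqB//.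
(* The limit [g] has zero square without being 0; Cauchy-Schwarz removes the cross term, and
   [r n - g] has the same square as [r n]. *)
have : Normc.normc (<|r n, g|>) ^+ 2 <= 0.
  by rewrite -(mulr0 (hsq (r n))) -g0; exact: cauchy_schwarz.
rewrite le_eqVlt ltNge sqr_ge0 orbF sqrf_eq0 => /eqP/Normc.eq0_normc ->.
by rewrite g0/=; lra.
Qed.

End parseval.

End hilbert_theory.

(** * Lower bounds for a seminorm on a Hilbert space *)

Section bounded_below.
Context (R : realType) (E : lmodType R[i]) (H : hilbert E).
Local Notation dom := (hdom H).
Local Notation "<| f , g |>" := (ip H f g) (format "<| f ,  g |>").
Local Notation hsq := (hsq H).
Local Notation hnorm := (hnorm H).
#[local] Hint Resolve hdomD hdomZ hdomN hdomB hdom0 : hd.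
Local Ltac hdm := by auto 10 with hd.

Variables (N : E -> R) (C : R).
Hypothesis ND : forall f g, dom f -> dom g -> N (f + g) <= N f + N g.
Hypothesis NZ : forall a f, dom f -> N (a *: f) = Normc.normc a * N f.
Hypothesis NC : forall f, dom f -> N f <= C * hnorm f.
Hypothesis N0 : forall f, dom f -> N f = 0 -> hsq f = 0.

Lemma seminormN f : dom f -> N (- f) = N f.
Proof. by move=> Hf; rewrite -scaleN1r NZ// normcN Normc.normc1 mul1r. Qed.

Lemma seminormB f g : dom f -> dom g -> N (f - g) <= N f + N g.
Proof. by move=> Hf Hg; rewrite -(seminormN Hg) ND//; hdm. Qed.

Lemma seminorm_ge0 f : dom f -> 0 <= N f.
Proof.
move=> Hf; have := seminormB Hf Hf; rewrite subrr.
rewrite -[X in N X](scale0r f) NZ// Normc.normc0 mul0r; lra.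
Qed.

(** For [n = 0] the orthogonality condition is void and the bound holds on all of [dom]. The
    seminorm [N] will be the norm of [f + K f]; working with a seminorm avoids asking for linearity
    of [K], which holds only up to null sets. *)
Definition bounded_below_on (e : nat -> E) n := exists2 c : R, 0 < c &
  forall f, dom f -> (forall i, (i < n)%N -> <|f, e i|> = 0) -> c * hnorm f <= N f.

(** Let [M] be the orthogonal of the larger family. If [x = e n] is at positive [N]-distance from
    [M], both parts of [f = z x + q], with [q] in [M], are controlled by [N f]. Otherwise some
    sequence of [M] tends to [x] for [N]; the bound on [M] makes it Cauchy, and its limit [g]
    satisfies [N (x - g) = 0] while being orthogonal to the unit vector [x], against the
    definiteness [N0]. *)
Lemma bounded_below_step e n : orthonormal_upto H e n.+1 ->
  bounded_below_on e n.+1 -> bounded_below_on e n.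
Proof.
move=> [De Oe] [c c0 hc]; set x := e n.
have Dx : dom x by exact: De.
have ix : <|x, x|> = 1 by rewrite Oe// eqxx.
have sx : hsq x = 1 by rewrite /hsq ix.
have nx : hnorm x = 1 by rewrite /hnorm sx sqrtr1.
pose M q := dom q /\ forall i, (i < n.+1)%N -> <|q, e i|> = 0.
have [[d d0 hd]|hn] := pselect (exists2 d, 0 < d & forall q, M q -> d <= N (x - q)).
  (* The first term bounds the coefficient of [x], which is at most [N f / d]. The second bounds
     [q], through [N q <= N f + N f / d * N x]. *)
  pose K := d^-1 + (1 + N x / d) / c.
  have Nx0 := seminorm_ge0 Dx.
  have K0 : 0 < K.
    by rewrite addr_gt0 ?invr_gt0// divr_gt0// ltr_wpDr// divr_ge0// ltW.
  exists K^-1; first by rewrite invr_gt0.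
  move=> f Df fe; set z := <|f, x|>; pose q := f - z *: x.
  have Dq : dom q by rewrite /q; hdm.
  have Mq : M q.
    split=> // i; rewrite ltnS leq_eqVlt => /orP[/eqP ->|ltin].
      by rewrite ipBl// ?ipZl// ?ix ?mulr1 ?subrr//; hdm.
    have De' : dom (e i) by apply: De; exact: ltnW.
    rewrite ipBl// ?ipZl//; last hdm.
    by rewrite fe// Oe// ?gtn_eqF ?mulr0 ?subr0// ltnW.
  have Nf0 := seminorm_ge0 Df.
  have zd : Normc.normc z * d <= N f.
    have [->|zn0] := eqVneq z 0; first by rewrite Normc.normc0 mul0r.
    have -> : f = z *: (x - (- z^-1 *: q)).
      rewrite scalerBr scalerA mulrN mulfV// scaleN1r opprK /q addrC.
      by rewrite subrK.
    rewrite NZ; last hdm.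
    apply: ler_wpM2l; first exact: normc_ge0.
    apply: hd; split; first by hdm.
    by move=> i ii; rewrite ipZl ?(proj2 Mq)// ?mulr0//; exact: De.
  have zd' : Normc.normc z <= N f / d by rewrite ler_pdivlMr.
  have Nq : N q <= N f * (1 + N x / d).
    apply: (le_trans (seminormB Df (hdomZ z Dx))).
    have -> : N f * (1 + N x / d) = N f + N f / d * N x by ring.
    by rewrite NZ// lerD2l; exact: ler_wpM2r.
  have qb : hnorm q <= N f * ((1 + N x / d) / c).
    rewrite mulrA ler_pdivlMr// mulrC; apply: le_trans Nq.
    by apply: hc => //; case: Mq.
  have fb : hnorm f <= N f * K.
    have -> : f = z *: x + q by rewrite /q addrC subrK.
    apply: (le_trans (ler_hnormD _ _)) => //; first hdm.
    have -> : z *: x + q = f by rewrite /q addrC subrK.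
    by rewrite hnormZ// nx mulr1 /K mulrDr lerD.
  by rewrite mulrC ler_pdivrMr.
exfalso.
(* Here the infimum of [N (x - q)] over [M] is 0. *)
have ex m : exists q, M q /\ N (x - q) <= m.+1%:R^-1.
  apply: contrapT => h; apply: hn; exists m.+1%:R^-1 => [|q Mq]; first by rewrite invr_gt0.
  by rewrite leNgt; apply/negP => /ltW h1; apply: h; exists q.
have [q hq] := choice ex.
have Dq m : dom (q m) by have [[]] := hq m.
have small (eps : R) : 0 < eps -> exists k, forall m, (k <= m)%N -> N (x - q m) <= eps.
  move=> eps0; exists (Num.truncn eps^-1) => m km.
  have [_ /le_trans] := hq m; apply.
  rewrite -[leRHS]invrK lef_pV2 ?posrE ?invr_gt0//.
  by apply/ltW/(lt_le_trans (Num.Theory.truncnS_gt _)); rewrite ler_nat ltnS.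
have cau (eps : R) : 0 < eps -> exists k, forall a b, (k <= a)%N -> (k <= b)%N ->
    Re (<|q a - q b, q a - q b|>) <= eps.
  move=> eps0; have s0 : 0 < Num.sqrt eps * c / 2 by rewrite !mulr_gt0 ?sqrtr_gt0// invr_gt0.
  have [k hk] := small _ s0; exists k => a b ka kb.
  have Dab : dom (q a - q b) by hdm.
  have : c * hnorm (q a - q b) <= Num.sqrt eps * c.
    have -> : Num.sqrt eps * c = Num.sqrt eps * c / 2 + Num.sqrt eps * c / 2 by field.
    apply: (@le_trans _ _ (N (q a - q b))).
      apply: hc => // i ii; rewrite ipBl//; last exact: De.
      by have [[_ ->//] _] := hq a; have [[_ ->//] _] := hq b; rewrite subrr.
    have -> : q a - q b = (x - q b) - (x - q a).
      by rewrite opprB [RHS]addrC addrA subrK.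
    apply: le_trans (seminormB _ _) _; [hdm|hdm|].
    by apply: lerD; exact: hk.
  rewrite mulrC ler_pM2r// => h.
  rewrite -/(hsq _) -sqr_hnorm// -(sqr_sqrtr (ltW eps0)).
  by rewrite ler_pXn2r// nnegrE ?hnorm_ge0// sqrtr_ge0.
have [g Dg hg] := hcomplete Dq cau.
have gx : <|g, x|> = 0.
  apply: Normc.eq0_normc; apply/eqP; rewrite -sqrf_eq0 eq_le sqr_ge0 andbT.
  apply/ler_addgt0Pr => eps eps0; rewrite add0r.
  have [k hk] := hg _ eps0; apply: le_trans (hk k (leqnn _)).
  have -> : <|g, x|> = <|g - q k, x|>.
    by rewrite ipBl//; have [[_ ->//] _] := hq k; rewrite subr0.
  rewrite -/(hsq _) hsq_subC//.
  by have := cauchy_schwarz (hdomB Dg (Dq k)) Dx; rewrite sx mulr1.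
have Ng : N (x - g) = 0.
  apply/eqP; rewrite eq_le seminorm_ge0 ?andbT; last hdm.
  apply/ler_addgt0Pr => eps eps0; rewrite add0r.
  pose C' := `|C| + 1.
  have C'0 : 0 < C' by rewrite ltr_wpDl.
  have e1 : 0 < eps / 2 by rewrite divr_gt0.
  have e2 : 0 < (eps / 2 / C') ^+ 2 by rewrite exprn_gt0// divr_gt0.
  have [k hk] := small _ e1; have [l hl] := hg _ e2.
  pose m := maxn k l.
  have -> : x - g = (x - q m) + (q m - g) by rewrite addrA subrK.
  apply: (le_trans (ND _ _)); [hdm|hdm|].
  have -> : eps = eps / 2 + eps / 2 by field.
  apply: lerD; first by apply: hk; exact: leq_maxl.
  have Dm : dom (q m - g) by hdm.
  apply: (le_trans (NC Dm)); apply: (@le_trans _ _ (C' * hnorm (q m - g))).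
    apply: ler_wpM2r; first exact: hnorm_ge0.
    by rewrite (le_trans (ler_norm _))// lerDl.
  rewrite mulrC -ler_pdivlMr// -(@ler_pXn2r _ 2)// ?nnegrE ?hnorm_ge0//.
    by rewrite sqr_hnorm//; apply: hl; exact: leq_maxr.
  by rewrite divr_ge0// ltW.
have := cauchy_schwarz (hdomB Dx Dg) Dx.
rewrite (N0 _ Ng) ?mul0r; last hdm.
by rewrite ipBl// gx ix subr0 Normc.normc1 expr1n ler10.
Qed.

Lemma bounded_below_of_bessel (B : nat) :
  (forall e n, orthonormal_upto H e n -> (forall i, (i < n)%N -> N (e i) <= 2^-1) ->
     (n <= B)%N) ->
  exists2 c : R, 0 < c & forall f, dom f -> c * hnorm f <= N f.
Proof.
move=> hB.
pose P n := `[< exists e, orthonormal_upto H e n /\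
  forall i, (i < n)%N -> N (e i) <= 2^-1 >].
have exP : exists n, P n by exists 0%N; apply/asboolP; exists (fun=> 0); split=> //; split.
have bP n : P n -> (n <= B)%N by move=> /asboolP[e [? ?]]; exact: (hB e).
case: (ex_maxnP exP bP) => n /asboolP[e [Oe Ne]] nmax.
have : bounded_below_on e n.
  exists 2^-1; first by rewrite invr_gt0.
  move=> f Df fe; have [f0|f0] := eqVneq (hnorm f) 0.
    by rewrite f0 mulr0; exact: seminorm_ge0.
  have fp : 0 < hnorm f by rewrite lt_neqAle eq_sym f0 hnorm_ge0.
  rewrite leNgt; apply/negP => Nf.
  (* If the bound failed at [f], normalising [f] would give one more vector for the family, against
     the maximality of [n]. *)
  pose g := ((hnorm f)^-1)%:C%C *: f.
  have Dg : dom g by rewrite /g; hdm.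
  have gg : <|g, g|> = 1.
    rewrite ip_hsq// /g hsqZ// normc_real ger0_norm ?invr_ge0 ?hnorm_ge0//.
    by rewrite -sqr_hnorm// exprVn mulVf// expf_neq0.
  have Ng : N g <= 2^-1.
    rewrite NZ// normc_real ger0_norm ?invr_ge0 ?hnorm_ge0//.
    by rewrite mulrC ler_pdivrMr// ltW.
  have ge i : (i < n)%N -> <|g, e i|> = 0.
    move=> ii; rewrite ipZl// ?fe ?mulr0//; by case: Oe => + _; exact.
  suff /nmax : P n.+1 by rewrite ltnn.
  case: Oe => De Oe; apply/asboolP; exists (fun i => if (i < n)%N then e i else g).
  split; [split=> [i _|i j ii jj]|move=> i _]; last first.
  - by case: ifPn => // /Ne.
  - case: ifPn => iin; case: ifPn => jn.
    + exact: Oe.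
    + rewrite (@ipC _ _ _ g (e i))//; last exact: De.
      rewrite ge// conjc0; have -> : j = n by apply/eqP; rewrite eqn_leq -ltnS jj leqNgt.
      by rewrite ltn_eqF.
    + rewrite ge//; have -> : i = n by apply/eqP; rewrite eqn_leq -ltnS ii leqNgt.
      by rewrite gtn_eqF.
    + rewrite gg; have -> : i = n by apply/eqP; rewrite eqn_leq -ltnS ii leqNgt.
      have -> : j = n by apply/eqP; rewrite eqn_leq -ltnS jj leqNgt.
      by rewrite eqxx.
  - by case: ifPn => // /De.
have : orthonormal_upto H e n by [].
clear -ND NZ NC N0; elim: n => [|n IH] Oe hb.
  by have [c c0 hc] := hb; exists c => // f Df; apply: hc.
apply: IH; last exact: bounded_below_step.
case: Oe => De Oe; split=> [i /ltnW|i j /ltnW ii /ltnW]; [exact: De|exact: Oe].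
Qed.

End bounded_below.

(** * Completeness of L2 *)

Section square_integrable.
Context (R : realType) (d : measure_display) (T : measurableType d).
Variables (mu : {measure set T -> \bar R}) (D : set T).
Hypothesis mD : measurable D.
Implicit Types h g : T -> R.

Definition sqint h := measurable_fun D h /\
  mu.-integrable D (fun x => (h x ^+ 2)%:E).

Lemma measurable_sqr h : measurable_fun D h ->
  measurable_fun D (fun x => h x ^+ 2).
Proof. by move=> mh; apply: measurable_funX. Qed.

Lemma sqintP h : measurable_fun D h ->
  (\int[mu]_(x in D) (h x ^+ 2)%:E < +oo)%E -> sqint h.
Proof.
move=> mh hf; split => //; apply/integrableP; split.
  by apply/measurable_EFinP; exact: measurable_sqr.
rewrite (eq_integral (fun x => (h x ^+ 2)%:E))// => x _ /=.
by rewrite ger0_norm ?sqr_ge0.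
Qed.

Lemma sqint_lty h : sqint h -> (\int[mu]_(x in D) (h x ^+ 2)%:E < +oo)%E.
Proof.
move=> [mh /integrableP[_]].
rewrite (eq_integral (fun x => (h x ^+ 2)%:E))// => x _ /=.
by rewrite ger0_norm ?sqr_ge0.
Qed.

Lemma sqint_mul h g : sqint h -> sqint g ->
  mu.-integrable D (fun x => (h x * g x)%:E).
Proof.
move=> [mh ih] [mg ig].
apply: (le_integrable mD _ _ (integrableD mD ih ig)).
  by apply/measurable_EFinP; exact: measurable_funM.
move=> x _; rewrite /= lee_fin [leRHS]ger0_norm ?addr_ge0 ?sqr_ge0//.
rewrite ler_norml; apply/andP; split.
  rewrite -subr_ge0; have := sqr_ge0 (h x + g x); have := sqr_ge0 (h x); have := sqr_ge0 (g x).
  by nra.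
have := sqr_ge0 (h x - g x); have := sqr_ge0 (h x); have := sqr_ge0 (g x).
by nra.
Qed.

Lemma sqintD h g : sqint h -> sqint g -> sqint (fun x => h x + g x).
Proof.
move=> hh hk; split; first by apply: measurable_funD; [case: hh|case: hk].
have i1 := sqint_mul hh hk.
have i2 := integrableD mD (integrableD mD (proj2 hh) (integrableD mD i1 i1)) (proj2 hk).
apply: eq_integrable i2 => // x _ /=.
by rewrite -!EFinD; congr EFin; ring.
Qed.

Lemma sqintZ (a : R) h : sqint h -> sqint (fun x => a * h x).
Proof.
move=> [mh ih]; split; first exact: measurable_funM.
apply: eq_integrable (integrableZl mD (a ^+ 2) ih) => // x _ /=.
by rewrite -EFinM exprMn.
Qed.

Lemma limn_einf_le (a : (\bar R)^nat) (b : \bar R) k0 :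
  (forall k, (k0 <= k)%N -> (a k <= b)%E) -> (limn_einf a <= b)%E.
Proof.
move=> ab; rewrite limn_einf_lim; apply: lime_le; first exact: is_cvg_einfs.
exists k0 => // k /= kk; apply: le_trans (ab _ kk).
by apply: ereal_inf_lbound; exists k => /=.
Qed.

(** * The Riesz-Fischer theorem for real functions *)

Section riesz_fischer.
Variable u : nat -> T -> R.
Hypothesis measurable_u : forall n, measurable_fun D (u n).
Hypothesis cau : forall eps : R, 0 < eps -> exists N, forall m n,
  (N <= m)%N -> (N <= n)%N ->
  (\int[mu]_(x in D) ((u m x - u n x) ^+ 2)%:E <= eps%:E)%E.

(** The steps are at most [sqrt B / 2^k], and [b k] is the sum of these bounds from rank [k] on. So
    [v + b] is nonincreasing, [v - b] is nondecreasing and bounds it from below, and [v] is the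
    difference of the convergent sequences [v + b] and [b]. *)
Lemma cvg_of_summable_steps (v : nat -> R) (B : R) :
  (forall k, (4 ^+ k * (v k.+1 - v k) ^+ 2) <= B) -> cvgn v.
Proof.
move=> hB; have B0 : 0 <= B by apply: le_trans (hB 0%N); rewrite mul1r sqr_ge0.
pose b k := 2 * Num.sqrt B * 2^-1 ^+ k.
have bS k : b k.+1 = b k / 2 by rewrite /b exprS; field.
have vb k : `|v k.+1 - v k| <= b k / 2.
  rewrite -(@ler_pXn2r _ 2)// ?nnegrE//; last first.
    by rewrite /b !mulr_ge0 ?sqrtr_ge0 ?exprn_ge0.
  rewrite real_normK ?num_real//.
  have -> : (b k / 2) ^+ 2 = B / 4 ^+ k.
    have -> : b k / 2 = Num.sqrt B * 2^-1 ^+ k by rewrite /b; field.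
    rewrite exprMn sqr_sqrtr// -exprM mulnC exprM; congr (_ * _).
    by rewrite -exprVn; congr (_ ^+ _); field.
  by rewrite ler_pdivlMr ?exprn_gt0// mulrC.
have b0 : b @ \oo --> (0 : R).
  rewrite -(mulr0 (2 * Num.sqrt B)); apply: cvgM; first exact: cvg_cst.
  by apply: cvg_expr; rewrite ger0_norm ?invr_ge0// invf_lt1// ltr1n.
have cw : cvgn (fun k => v k + b k).
  apply: nonincreasing_is_cvgn.
    apply/nonincreasing_seqP => k; have := vb k; rewrite ler_norml bS => /andP[_]; lra.
  exists (v 0%N - b 0%N) => _ [k _ <-].
  have : v 0%N - b 0%N <= v k - b k.
    elim: k => // k IH; apply: (le_trans IH).
    have := vb k; rewrite ler_norml bS => /andP[+ _]; lra.
  have : 0 <= b k by rewrite /b !mulr_ge0 ?sqrtr_ge0 ?exprn_ge0.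
  lra.
have -> : v = (fun k => (v k + b k) - b k) by apply/funext => k; rewrite addrK.
by apply: is_cvgB => //; apply/cvg_ex; exists 0.
Qed.

Lemma riesz_fischer : exists2 g : T -> R, measurable_fun D g &
  forall eps : R, 0 < eps -> exists N, forall n, (N <= n)%N ->
    (\int[mu]_(x in D) ((u n x - g x) ^+ 2)%:E <= eps%:E)%E.
Proof.
have /choice[N hN] k : exists N, forall m n, (N <= m)%N -> (N <= n)%N ->
    (\int[mu]_(x in D) ((u m x - u n x) ^+ 2)%:E <= (2^-1 / 8 ^+ k)%:E)%E.
  by apply: cau; rewrite divr_gt0 ?exprn_gt0 ?invr_gt0.
(* Along the subsequence [v], the squared norms of the steps are at most 8^-k / 2,
   so that the series of the 4^k |v_(k+1) - v_k|^2 is integrable. *)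
pose phi k := (\sum_(j < k.+1) N j + k)%N.
have phiN j k : (j <= k)%N -> (N j <= phi k)%N.
  move=> jk; rewrite /phi (bigD1 (Ordinal (jk : (j < k.+1)%N)))//=.
  by rewrite -addnA leq_addr.
pose v k := u (phi k).
pose F k x := (4 ^+ k * (v k.+1 x - v k x) ^+ 2)%:E.
have mF k : measurable_fun D (F k).
  apply/measurable_EFinP; apply: measurable_funM => //.
  by apply: measurable_sqr; apply: measurable_funB; exact: measurable_u.
have F0 k x : D x -> (0 <= F k x)%E.
  by move=> _; rewrite lee_fin mulr_ge0 ?sqr_ge0 ?exprn_ge0.
have intF k : (\int[mu]_(x in D) F k x <= (2^-1 ^+ k.+1)%:E)%E.
  have -> : (\int[mu]_(x in D) F k x =
      (4 ^+ k)%:E * \int[mu]_(x in D) ((v k.+1 x - v k x) ^+ 2)%:E)%E.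
    rewrite -ge0_integralZl//.
    - by apply/measurable_EFinP; apply: measurable_sqr; apply: measurable_funB; exact: measurable_u.
    - by move=> x _; rewrite lee_fin sqr_ge0.
  have -> : (2^-1 ^+ k.+1)%:E = ((4 ^+ k)%:E * (2^-1 / 8 ^+ k)%:E)%E :> \bar R.
    rewrite -EFinM; congr EFin; rewrite exprS mulrCA; congr (_ * _).
    rewrite -exprVn -exprMn; congr (_ ^+ _); by field.
  apply: lee_wpmul2l; first by rewrite lee_fin exprn_ge0.
  by apply: hN; apply: phiN.
pose S x := (\sum_(0 <= k <oo) F k x)%E.
have mS : measurable_fun D S by apply: ge0_emeasurable_sum => // k x Dx _; exact: F0.
have intS : (\int[mu]_(x in D) S x < +oo)%E.
  rewrite integral_nneseries//.
  apply: (@le_lt_trans _ _ (\sum_(0 <= k <oo) (1 / (2 ^ k.+1)%:R)%:E)%E).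
    apply: lee_nneseries => k _; first by move=> _; apply: integral_ge0 => x; exact: F0.
    apply: le_trans (intF k) _.
    by rewrite lee_fin div1r natrX exprVn.
  by apply: le_lt_trans (epsilon_trick0 xpredT (@ler01 R)) _; rewrite ltry.
have S0 x : D x -> (0 <= S x)%E by move=> Dx; apply: nneseries_ge0 => k _ _; exact: F0.
have iS : mu.-integrable D S.
  apply/integrableP; split => //.
  rewrite (eq_integral S)// => x /set_mem Dx; rewrite gee0_abs//; exact: S0.
(* The upper limit is measurable whether or not the sequence converges, and [fine] gives a real
   value on the null set where it might be infinite. *)
pose g x := fine (limn_esup (fun k => (v k x)%:E)).
have mg : measurable_fun D g.
  apply: measurableT_comp => //.
  by apply: measurable_fun_limn_esup => // k; apply/measurable_EFinP; exact: measurable_u.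
have cvg_ae : {ae mu, forall x, D x -> (fun k => v k x) @ \oo --> g x}.
  apply: filterS (integrable_ae mD iS) => x h Dx.
  have Sfin := h Dx.
  have cv : cvgn (fun k => v k x).
    apply: (@cvg_of_summable_steps _ (fine (S x))) => k.
    rewrite -lee_fin fineK// -/(F k x) /S (@nneseriesD1 _ _ k)//; last first.
      by move=> j _; exact: F0.
    by apply: leeDl; apply: nneseries_ge0 => j _ _; exact: F0.
  rewrite /g; suff -> : limn_esup (fun k => (v k x)%:E) = (limn (fun k => v k x))%:E by [].
  have ce : (fun k => (v k x)%:E) @ \oo --> (limn (fun k => v k x))%:E by apply: cvg_EFin => //; exact: nearW.
  by rewrite is_cvg_limn_esupE; [exact/cvg_lim|apply/cvg_ex; eexists; exact: ce].
exists g => // eps eps0; have [N0 hN0] := cau eps0; exists N0 => n nN.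
pose G k x := ((u n x - v k x) ^+ 2)%:E.
have mG k : measurable_fun D (G k).
  by apply/measurable_EFinP; apply: measurable_sqr; apply: measurable_funB; exact: measurable_u.
have G0 k x : D x -> (0 <= G k x)%E by move=> _; rewrite /G lee_fin sqr_ge0.
(* Almost everywhere the square is a lower limit along the subsequence, so that Fatou's lemma
   carries the Cauchy bound over to [g]. *)
have -> : (\int[mu]_(x in D) ((u n x - g x) ^+ 2)%:E =
    \int[mu]_(x in D) limn_einf (G ^~ x))%E.
  apply: ge0_ae_eq_integral => //.
  - by apply/measurable_EFinP; apply: measurable_sqr; exact: measurable_funB.
  - rewrite (_ : (fun x => limn_einf (G ^~ x)) =
        -%E \o (fun x => limn_esup (fun k => (- G k x)%E))).
      apply: measurableT_comp => //; apply: measurable_fun_limn_esup => k.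
      exact: measurableT_comp.
    apply/funext => x; rewrite [RHS]/comp -limn_einfN; congr limn_einf.
    by apply/funext => k; rewrite [RHS]/comp oppeK.
  - by move=> x _; rewrite lee_fin sqr_ge0.
  - move=> x Dx; rewrite limn_einf_lim; apply: lime_ge; first exact: is_cvg_einfs.
    by apply: nearW => k; apply: le_ereal_inf_tmp => _ [j _ <-]; exact: G0.
  apply: filterS cvg_ae => x h Dx; have {}h := h Dx.
  have cG : (G ^~ x) @ \oo --> ((u n x - g x) ^+ 2)%:E.
    apply: cvg_EFin; first by apply: nearW.
    by rewrite /comp /G /=; apply: cvgM; apply: cvgB => //; exact: cvg_cst.
  by rewrite is_cvg_limn_einfE; [apply/esym/cvg_lim|apply/cvg_ex; eexists; exact: cG].
apply: le_trans (fatou mu mD mG G0) _.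
apply: (@limn_einf_le _ _ N0) => k kk.
apply: hN0 => //; apply: leq_trans kk _; exact: leq_addl.
Qed.
End riesz_fischer.
End square_integrable.

(** * Integrals of complex functions and the Hilbert space of square integrable ones *)

Section complex_integral.
Context (R : realType) (d : measure_display) (T : measurableType d).
Variables (mu : {measure set T -> \bar R}) (D : set T).
Hypothesis mD : measurable D.
Implicit Types f g : T -> R[i].

Lemma measurable_funCD f g : measurable_funC D f -> measurable_funC D g ->
  measurable_funC D (fun x => f x + g x).
Proof.
move=> [rf jf] [rg jg]; split.
  by under eq_fun do rewrite cReD; exact: measurable_funD.
by under eq_fun do rewrite cImD; exact: measurable_funD.
Qed.

Lemma measurable_funCM f g : measurable_funC D f -> measurable_funC D g ->
  measurable_funC D (fun x => f x * g x).
Proof.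
move=> [rf jf] [rg jg]; split.
  under eq_fun do rewrite cReM.
  by apply: measurable_funB; apply: measurable_funM.
under eq_fun do rewrite cImM.
by apply: measurable_funD; apply: measurable_funM.
Qed.

Lemma measurable_funCJ f : measurable_funC D f ->
  measurable_funC D (fun x => (f x)^*%C).
Proof.
move=> [rf jf]; split; first by under eq_fun do rewrite cReJ.
by under eq_fun do rewrite cImJ; exact: measurableT_comp.
Qed.

Lemma measurable_funC_cst (a : R[i]) : measurable_funC D (fun=> a).
Proof. by split; exact: measurable_cst. Qed.

Lemma measurable_funC_real (h : T -> R) : measurable_fun D h ->
  measurable_funC D (fun x => (h x)%:C%C).
Proof. by move=> mh; split => //; exact: measurable_cst. Qed.

Lemma measurable_funC_normsq f : measurable_funC D f ->
  measurable_fun D (fun x => Normc.normc (f x) ^+ 2).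
Proof.
move=> [rf jf]; under eq_fun do rewrite sqr_normcE.
by apply: measurable_funD; exact: measurable_funX.
Qed.

Definition integrableC f :=
  mu.-integrable D (fun x => (Re (f x))%:E) /\
  mu.-integrable D (fun x => (Im (f x))%:E).

Lemma integrableCZ (a : R[i]) f : integrableC f -> integrableC (fun x => a * f x).
Proof.
move=> [rf jf]; split.
  apply: eq_integrable (integrableB mD (integrableZl mD (Re a) rf)
    (integrableZl mD (Im a) jf)) => // x _ /=.
  by rewrite cReM EFinB !EFinM.
apply: eq_integrable (integrableD mD (integrableZl mD (Re a) jf)
  (integrableZl mD (Im a) rf)) => // x _ /=.
by rewrite cImM EFinD !EFinM.
Qed.

Lemma eq_integralC f g : (forall x, D x -> f x = g x) ->
  integralC mu D f = integralC mu D g.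
Proof.
by move=> fg; rewrite /integralC; congr Complex; apply: eq_Rintegral => x /set_mem Dx;
  rewrite fg.
Qed.

Lemma integralCD f g : integrableC f -> integrableC g ->
  integralC mu D (fun x => f x + g x) = integralC mu D f + integralC mu D g.
Proof.
move=> [rf jf] [rg jg]; apply: complexP; rewrite ?cReD ?cImD /=.
  by rewrite -RintegralD//; apply: eq_Rintegral => x _; rewrite cReD.
by rewrite -RintegralD//; apply: eq_Rintegral => x _; rewrite cImD.
Qed.

Lemma integralCZ (a : R[i]) f : integrableC f ->
  integralC mu D (fun x => a * f x) = a * integralC mu D f.
Proof.
move=> [rf jf]; apply: complexP; rewrite ?cReM ?cImM /=.
  rewrite -!RintegralZl// -RintegralB//; last 2 first.
    exact: (integrableZl mD (Re a) rf).
    exact: (integrableZl mD (Im a) jf).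
  by apply: eq_Rintegral => x _; rewrite cReM.
rewrite -!RintegralZl// -RintegralD//; last 2 first.
  exact: (integrableZl mD (Re a) jf).
  exact: (integrableZl mD (Im a) rf).
by apply: eq_Rintegral => x _; rewrite cImM.
Qed.

Lemma integralCJ f : integrableC f ->
  integralC mu D (fun x => (f x)^*%C) = (integralC mu D f)^*%C.
Proof.
move=> [rf jf]; apply: complexP; rewrite ?cReJ ?cImJ /=.
  by apply: eq_Rintegral => x _; rewrite cReJ.
rewrite -mulN1r -RintegralZl//; apply: eq_Rintegral => x _.
by rewrite cImJ mulN1r.
Qed.

Lemma ae_eq_integralC f g : measurable_funC D f -> measurable_funC D g ->
  ae_eqC mu D f g -> integralC mu D f = integralC mu D g.
Proof.
move=> [rf jf] [rg jg] fg; rewrite /integralC /Rintegral; congr Complex; congr fine.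
  apply: ae_eq_integral => //; [exact/measurable_EFinP|exact/measurable_EFinP|].
  by apply: filterS fg => x h Dx; rewrite h.
apply: ae_eq_integral => //; [exact/measurable_EFinP|exact/measurable_EFinP|].
by apply: filterS fg => x h Dx; rewrite h.
Qed.

Lemma normsq2E f : measurable_funC D f ->
  normsq2 mu D f = (\int[mu]_(x in D) (Re (f x) ^+ 2)%:E +
                    \int[mu]_(x in D) (Im (f x) ^+ 2)%:E)%E.
Proof.
move=> [rf jf]; rewrite /normsq2 -ge0_integralD//; last 4 first.
- by move=> x _; rewrite lee_fin sqr_ge0.
- by apply/measurable_EFinP; exact: measurable_funX.
- by move=> x _; rewrite lee_fin sqr_ge0.
- by apply/measurable_EFinP; exact: measurable_funX.
by apply: eq_integral => x _; rewrite sqr_normcE EFinD.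
Qed.

Lemma normsq2_ge0 f : (0 <= normsq2 mu D f)%E.
Proof. by apply: integral_ge0 => x _; rewrite lee_fin sqr_ge0. Qed.

Lemma L2P f : L2 mu D f <->
  sqint mu D (fun x => Re (f x)) /\ sqint mu D (fun x => Im (f x)).
Proof.
have i0 (h : T -> R) : (0 <= \int[mu]_(x in D) (h x ^+ 2)%:E)%E.
  by apply: integral_ge0 => x _; rewrite lee_fin sqr_ge0.
split=> [[mf]|[sr si]].
  rewrite normsq2E// => fin; case: mf => rf jf; split; apply: sqintP => //.
    by apply: le_lt_trans fin; rewrite leeDl.
  by apply: le_lt_trans fin; rewrite leeDr.
have mf : measurable_funC D f by split; [case: sr|case: si].
split=> //; rewrite normsq2E//; apply: lte_add_pinfty; exact: sqint_lty.
Qed.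

Lemma L2D f g : L2 mu D f -> L2 mu D g -> L2 mu D (fun x => f x + g x).
Proof.
move=> /L2P[rf jf] /L2P[rg jg]; apply/L2P; split.
  by under eq_fun do rewrite cReD; exact: sqintD.
by under eq_fun do rewrite cImD; exact: sqintD.
Qed.

Lemma L2_le f (g : T -> R[i]) : measurable_funC D f ->
  (forall x, D x -> Normc.normc (f x) <= Normc.normc (g x)) ->
  L2 mu D g -> L2 mu D f.
Proof.
move=> mf fg [mg g2]; split=> //; apply: le_lt_trans g2.
apply: ge0_le_integral => //.
- by move=> x _; rewrite lee_fin sqr_ge0.
- by apply/measurable_EFinP; exact: measurable_funC_normsq.
- by apply/measurable_EFinP; exact: measurable_funC_normsq.
- move=> x Dx; rewrite lee_fin ler_pXn2r ?nnegrE ?normc_ge0//; exact: fg.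
Qed.

Lemma L2Z (a : R[i]) f : L2 mu D f -> L2 mu D (fun x => a * f x).
Proof.
move=> /L2P[rf jf]; apply/L2P; split.
  under eq_fun do rewrite cReM -mulNr.
  by apply: sqintD => //; exact: sqintZ.
under eq_fun do rewrite cImM.
by apply: sqintD => //; exact: sqintZ.
Qed.

Lemma L2J f : L2 mu D f -> L2 mu D (fun x => (f x)^*%C).
Proof.
move=> hf; apply: L2_le (hf); first by apply: measurable_funCJ; case: hf.
by move=> x _; rewrite normcJE.
Qed.

Lemma L20 : L2 mu D (fun=> 0).
Proof.
split; first exact: measurable_funC_cst.
by rewrite /normsq2 integral0_eq// => x _; rewrite Normc.normc0 expr0n.
Qed.

Lemma L2_mul f g : L2 mu D f -> L2 mu D g -> integrableC (fun x => f x * g x).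
Proof.
move=> /L2P[rf jf] /L2P[rg jg]; split.
  have i1 := integrableB mD (sqint_mul mD rf rg) (sqint_mul mD jf jg).
  by apply: eq_integrable i1 => // x _ /=; rewrite cReM EFinB.
have i1 := integrableD mD (sqint_mul mD rf jg) (sqint_mul mD jf rg).
by apply: eq_integrable i1 => // x _ /=; rewrite cImM EFinD.
Qed.

Lemma L2_inner f g : L2 mu D f -> L2 mu D g ->
  integrableC (fun x => f x * (g x)^*%C).
Proof. by move=> hf hg; exact: L2_mul (L2J hg). Qed.

Lemma inner2_normsq2 f : inner2 mu D f f = (fine (normsq2 mu D f))%:C%C.
Proof.
rewrite /inner2 /integralC; apply: complexP => /=.
  rewrite /Rintegral /normsq2; congr fine; apply: eq_integral => x _.
  by rewrite mulcJ.
rewrite /Rintegral (eq_integral (fun=> 0%E)) ?integral0// => x _.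
by rewrite mulcJ.
Qed.

Lemma fine_normsq2K f : L2 mu D f -> (fine (normsq2 mu D f))%:E = normsq2 mu D f.
Proof. by move=> [_ hf]; rewrite fineK// ge0_fin_numE// normsq2_ge0. Qed.

Lemma normsq2_eq0 f : measurable_funC D f -> fine (normsq2 mu D f) = 0 ->
  (normsq2 mu D f < +oo)%E -> ae_eqC mu D f (fun=> 0).
Proof.
move=> mf f0 fin; have : normsq2 mu D f = 0.
  by rewrite -[LHS]fineK ?f0// ge0_fin_numE// normsq2_ge0.
have mf2 : measurable_fun D (fun x => ((Normc.normc (f x)) ^+ 2)%:E).
  by apply/measurable_EFinP; exact: measurable_funC_normsq.
rewrite /normsq2 => h.
have /(ae_eq_integral_abs _ mD mf2) : (\int[mu]_(x in D) `|((Normc.normc (f x)) ^+ 2)%:E|)%E = 0%E.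
  by rewrite -[RHS]h; apply: eq_integral => x _; rewrite gee0_abs// lee_fin sqr_ge0.
apply: filterS => x hx Dx; have := hx Dx; move=> /= [].
by move/eqP; rewrite sqrf_eq0 => /eqP/Normc.eq0_normc.
Qed.

Lemma ae_normsq2_eq0 f : measurable_funC D f -> ae_eqC mu D f (fun=> 0) ->
  normsq2 mu D f = 0%E.
Proof.
move=> mf f0; rewrite /normsq2.
rewrite (ge0_ae_eq_integral (g := fun=> 0%E)) ?integral0//.
- by apply/measurable_EFinP; exact: measurable_funC_normsq.
- by move=> x _; rewrite lee_fin sqr_ge0.
- by apply: filterS f0 => x hx Dx; rewrite hx// Normc.normc0 expr0n.
Qed.

Lemma ae_eq_normsq2 f g : measurable_funC D f -> measurable_funC D g ->
  ae_eqC mu D f g -> normsq2 mu D f = normsq2 mu D g.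
Proof.
move=> mf mg fg; apply: ge0_ae_eq_integral => //.
- by apply/measurable_EFinP; exact: measurable_funC_normsq.
- by apply/measurable_EFinP; exact: measurable_funC_normsq.
- by move=> x _; rewrite lee_fin sqr_ge0.
- by move=> x _; rewrite lee_fin sqr_ge0.
- by apply: filterS fg => x hx Dx; rewrite hx.
Qed.

Local Notation E := (T -> R[i]^o).

Lemma L2_complete (u : nat -> E) : (forall n, L2 mu D (u n)) ->
  (forall eps : R, 0 < eps -> exists N, forall m n, (N <= m)%N -> (N <= n)%N ->
     Re (inner2 mu D (u m - u n) (u m - u n)) <= eps) ->
  exists2 g : E, L2 mu D g &
    forall eps : R, 0 < eps -> exists N, forall n, (N <= n)%N ->
      Re (inner2 mu D (u n - g) (u n - g)) <= eps.
Proof.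
move=> hu cau.
have L2B (f g : E) : L2 mu D f -> L2 mu D g -> L2 mu D (f - g).
  move=> hf /(L2Z (-1)) hg; have := L2D hf hg.
  by under eq_fun do rewrite mulN1r.
have i0 (h : T -> R) : (0 <= \int[mu]_(x in D) (h x ^+ 2)%:E)%E.
  by apply: integral_ge0 => x _; rewrite lee_fin sqr_ge0.
have cauN (eps : R) : 0 < eps -> exists N, forall m n, (N <= m)%N -> (N <= n)%N ->
   (normsq2 mu D (u m - u n)%R <= eps%:E)%E.
  move=> /cau[N hN]; exists N => m n mN nN; have := hN _ _ mN nN.
  by rewrite inner2_normsq2/= -lee_fin fine_normsq2K//; exact: L2B.
have [gr mgr hgr] : exists2 g : T -> R, measurable_fun D g &
    forall eps : R, 0 < eps -> exists N, forall n, (N <= n)%N ->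
    (\int[mu]_(x in D) ((Re (u n x) - g x) ^+ 2)%:E <= eps%:E)%E.
  apply: riesz_fischer => // [n|eps /cauN[N hN]]; first by have [[]] := hu n.
  exists N => m n mN nN; apply: le_trans (hN _ _ mN nN).
  rewrite normsq2E; last by case: (L2B _ _ (hu m) (hu n)).
  apply: (@le_trans _ _ (\int[mu]_(x in D) (Re ((u m - u n) x) ^+ 2)%:E)%E).
    by rewrite le_eqVlt; apply/orP; left; apply/eqP; apply: eq_integral => x _;
      rewrite cReD cReN.
  by rewrite leeDl.
have [gi mgi hgi] : exists2 g : T -> R, measurable_fun D g &
    forall eps : R, 0 < eps -> exists N, forall n, (N <= n)%N ->
    (\int[mu]_(x in D) ((Im (u n x) - g x) ^+ 2)%:E <= eps%:E)%E.
  apply: riesz_fischer => // [n|eps /cauN[N hN]]; first by have [[]] := hu n.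
  exists N => m n mN nN; apply: le_trans (hN _ _ mN nN).
  rewrite normsq2E; last by case: (L2B _ _ (hu m) (hu n)).
  apply: (@le_trans _ _ (\int[mu]_(x in D) (Im ((u m - u n) x) ^+ 2)%:E)%E).
    by rewrite le_eqVlt; apply/orP; left; apply/eqP; apply: eq_integral => x _;
      rewrite cImD cImN.
  by rewrite leeDr.
pose g : E := fun x => Complex (gr x) (gi x).
have mg : measurable_funC D g by [].
have mug n : measurable_funC D (u n - g).
  have [mu_ _] := hu n; have := measurable_funCD mu_ (measurable_funCM (measurable_funC_cst (-1)) mg).
  by under eq_fun do rewrite mulN1r.
have key (eps : R) : 0 < eps -> exists N, forall n, (N <= n)%N ->
    (normsq2 mu D (u n - g)%R <= eps%:E)%E.
  move=> eps0; have e2 : 0 < eps / 2 by rewrite divr_gt0.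
  have [N hN] := hgr _ e2; have [M hM] := hgi _ e2.
  exists (maxn N M) => n; rewrite geq_max => /andP[nN nM].
  rewrite normsq2E// (_ : eps = eps / 2 + eps / 2); last by field.
  rewrite EFinD; apply: leeD.
    apply: le_trans (hN _ nN); rewrite le_eqVlt; apply/orP; left; apply/eqP.
    by apply: eq_integral => x _; rewrite cReD cReN.
  apply: le_trans (hM _ nM); rewrite le_eqVlt; apply/orP; left; apply/eqP.
  by apply: eq_integral => x _; rewrite cImD cImN.
(* [g] is the difference of [u n] and [u n - g], so one rank at a finite distance suffices. *)
have hug n : (normsq2 mu D (u n - g)%R < +oo)%E -> L2 mu D g.
  move=> fin; have := L2D (hu n) (L2Z (-1) (conj (mug n) fin)).
  under eq_fun => x do rewrite mulN1r [X in _ - X](_ : _ = u n x - g x)// subKr.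
  by [].
have hg : L2 mu D g.
  have [N hN] := key 1 ltr01; apply: (hug N); apply: le_lt_trans (hN _ (leqnn _)) _.
  by rewrite ltry.
exists g => // eps /key[N hN]; exists N => n /hN.
by rewrite inner2_normsq2/= -lee_fin fine_normsq2K//; exact: L2B.
Qed.

Lemma L2_inner2Pl (a : R[i]) (f g h : E) : L2 mu D f -> L2 mu D g -> L2 mu D h ->
  inner2 mu D (a *: f + g) h = a * inner2 mu D f h + inner2 mu D g h.
Proof.
move=> hf hg hh; rewrite /inner2 -integralCZ; last exact: L2_inner.
rewrite -integralCD; last 2 first.
  by apply: integrableCZ; exact: L2_inner.
  exact: L2_inner.
by apply: eq_integralC => x _; rewrite mulrA -mulrDl.
Qed.

Lemma L2_inner2C (f g : E) : L2 mu D f -> L2 mu D g ->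
  inner2 mu D g f = (inner2 mu D f g)^*%C.
Proof.
move=> hf hg; rewrite /inner2 -integralCJ; last exact: L2_inner.
by apply: eq_integralC => x _; rewrite conjcM conjcK mulrC.
Qed.

Lemma L2_linear (a : R[i]) (f g : E) : L2 mu D f -> L2 mu D g -> L2 mu D (a *: f + g).
Proof. by move=> /(L2Z a) hf hg; exact: L2D hf hg. Qed.

Lemma inner2_ge0 (f : E) : L2 mu D f -> 0 <= inner2 mu D f f.
Proof. by move=> _; rewrite inner2_normsq2 ler0c fine_ge0// normsq2_ge0. Qed.

Definition L2_hilbert : hilbert E := @Hilbert R E (L2 mu D) (inner2 mu D)
  L20 L2_linear L2_inner2Pl L2_inner2C inner2_ge0 L2_complete.

Lemma hsq_normsq2 (f : E) : hsq L2_hilbert f = fine (normsq2 mu D f).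
Proof. by rewrite [LHS](_ : _ = Re (inner2 mu D f f))// inner2_normsq2. Qed.

End complex_integral.

(** * Hilbert-Schmidt operators *)

Section hilbert_schmidt.
Context (R : realType) (d : measure_display) (T : measurableType d).
Variable mu : {sigma_finite_measure set T -> \bar R}.
Local Notation mu2 := (mu \x mu)%E.
Implicit Types (k : T * T -> R[i]) (f g : T -> R[i]).
Local Notation L2T := (L2 mu setT).
Local Notation H := (L2_hilbert mu measurableT).

(** No integrability is assumed: the integrals of the positive and negative parts are measurable by
    Tonelli, and [fine] of their difference is what [Rintegral] means even where both are
    infinite. *)
Lemma measurable_Rintegral_section (h : T * T -> R) : measurable_fun setT h ->
  measurable_fun setT (fun x => (\int[mu]_y h (x, y))%R).
Proof.
move=> mh; have mh' : measurable_fun setT (EFin \o h) by exact/measurable_EFinP.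
rewrite (_ : (fun x => _) =
  fine \o (fubini_F mu (EFin \o h)^\+ \- fubini_F mu (EFin \o h)^\-)%E).
  apply: measurableT_comp => //; apply: emeasurable_funB.
    apply: measurable_fun_fubini_tonelli_F; last exact: funepos_ge0.
    exact: measurable_funepos.
  apply: measurable_fun_fubini_tonelli_F; last exact: funeneg_ge0.
  exact: measurable_funeneg.
apply/funext => x; rewrite /Rintegral integralE /=; congr (fine (_ - _)).
  by apply: eq_integral => y _; rewrite !funeposE.
by apply: eq_integral => y _; rewrite !funenegE.
Qed.

Lemma measurable_section (h : T * T -> R) x : measurable_fun setT h ->
  measurable_fun setT (fun y => h (x, y)).
Proof. by move=> mh; apply: measurableT_comp mh _; exact: measurable_pair1. Qed.

Lemma measurable_funC_section k x : measurable_funC setT k ->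
  measurable_funC setT (fun y => k (x, y)).
Proof. by move=> [rk jk]; split; [exact: (measurable_section _ rk)|exact: (measurable_section _ jk)]. Qed.

Lemma measurable_funC_fst f : measurable_funC setT f ->
  measurable_funC setT (fun p : T * T => f p.1).
Proof. by move=> [rf jf]; split; [apply: (measurableT_comp rf)|apply: (measurableT_comp jf)]. Qed.

Lemma measurable_funC_snd f : measurable_funC setT f ->
  measurable_funC setT (fun p : T * T => f p.2).
Proof. by move=> [rf jf]; split; [apply: (measurableT_comp rf)|apply: (measurableT_comp jf)]. Qed.

Lemma measurable_funC_swap k : measurable_funC setT k ->
  measurable_funC setT (fun p : T * T => k (p.2, p.1)).
Proof.
have ms : measurable_fun setT (fun p : T * T => (p.2, p.1)).
  exact: measurable_fun_pair measurable_snd measurable_fst.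
by move=> [rf jf]; split; [apply: (measurableT_comp rf)|apply: (measurableT_comp jf)].
Qed.

Lemma fubini_integralC (F : T * T -> R[i]) : integrableC mu2 setT F ->
  integralC mu setT (fun x => integralC mu setT (fun y => F (x, y))) =
  integralC mu setT (fun y => integralC mu setT (fun x => F (x, y))).
Proof.
have H1 (h : T * T -> R) : mu2.-integrable setT (EFin \o h) ->
    (\int[mu]_x (\int[mu]_y h (x, y)))%R = fine (\int[mu2]_z (h z)%:E)%E.
  move=> ih; rewrite -(integral12_prod_meas1 ih) /Rintegral; congr fine.
  apply: ae_eq_integral => //.
  - apply/measurable_EFinP; apply: measurableT_comp => //; exact: measurable_fubini_F ih.
  - exact: measurable_fubini_F ih.
  apply: filterS (ae_integrable1 ih) => x hx _; rewrite fineK//.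
  exact: integrable_fin_num hx.
have H2 (h : T * T -> R) : mu2.-integrable setT (EFin \o h) ->
    (\int[mu]_y (\int[mu]_x h (x, y)))%R = fine (\int[mu2]_z (h z)%:E)%E.
  move=> ih; rewrite -(integral21_prod_meas1 ih) /Rintegral; congr fine.
  apply: ae_eq_integral => //.
  - apply/measurable_EFinP; apply: measurableT_comp => //; exact: measurable_fubini_G ih.
  - exact: measurable_fubini_G ih.
  apply: filterS (ae_integrable2 ih) => x hx _; rewrite fineK//.
  exact: integrable_fin_num hx.
move=> [rF jF]; rewrite /integralC /=; congr Complex.
  exact: etrans (H1 _ rF) (esym (H2 _ rF)).
exact: etrans (H1 _ jF) (esym (H2 _ jF)).
Qed.

Definition hs_op k f : T -> R[i] :=
  fun x => integralC mu setT (fun y => k (x, y) * f y).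

Lemma measurable_hs_op k f : measurable_funC setT k -> measurable_funC setT f ->
  measurable_funC setT (hs_op k f).
Proof.
move=> mk mf; have [rF jF] := measurable_funCM mk (measurable_funC_snd mf).
by split; [exact: measurable_Rintegral_section rF|exact: measurable_Rintegral_section jF].
Qed.

Section kernel.
Variable k : T * T -> R[i].
Hypothesis kL2 : L2 mu2 setT k.
Let mk : measurable_funC setT k. Proof. by case: kL2. Qed.
Let row x : T -> R[i]^o := fun y => k (x, y).

Let mk2 : measurable_fun setT (fun p => ((Normc.normc (k p)) ^+ 2)%:E).
Proof. by apply/measurable_EFinP; exact: measurable_funC_normsq. Qed.

Let k2_ge0 p : (0 <= ((Normc.normc (k p)) ^+ 2)%:E)%E.
Proof. by rewrite lee_fin sqr_ge0. Qed.

Lemma normsq2_kernel : normsq2 mu2 setT k = (\int[mu]_x normsq2 mu setT (row x))%E.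
Proof. exact: fubini_tonelli1 mk2 k2_ge0. Qed.

Lemma measurable_normsq2_row : measurable_fun setT (fun x => normsq2 mu setT (row x)).
Proof. exact: measurable_fun_fubini_tonelli_F mk2 k2_ge0. Qed.

Lemma ae_row_L2 : {ae mu, forall x, L2T (row x)}.
Proof.
have : mu.-integrable setT (fun x => normsq2 mu setT (row x)).
  apply/integrableP; split; first exact: measurable_normsq2_row.
  rewrite (eq_integral (fun x => normsq2 mu setT (row x))).
    by rewrite -normsq2_kernel; case: kL2.
  by move=> x _; rewrite gee0_abs// normsq2_ge0.
move=> /(integrable_ae measurableT); apply: filterS => x /(_ I) hx.
split; first exact: measurable_funC_section.
by rewrite -ge0_fin_numE// normsq2_ge0.
Qed.

(** Both Hilbert-Schmidt estimates below reduce to a bound at fixed [x]. It is asked only where the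
    row of the kernel is square integrable, which by Tonelli is almost everywhere. *)
Lemma integral_le_rows (F : T -> R) (c : R) : 0 <= c -> measurable_fun setT F ->
  (forall x, 0 <= F x) ->
  (forall x, L2T (row x) -> F x <= c * fine (normsq2 mu setT (row x))) ->
  (\int[mu]_x (F x)%:E <= (c * fine (normsq2 mu2 setT k))%:E)%E.
Proof.
move=> c0 mF F0 Fk; rewrite EFinM fine_normsq2K// normsq2_kernel.
rewrite -ge0_integralZl//; last 2 first.
- exact: measurable_normsq2_row.
- by move=> x _; exact: normsq2_ge0.
apply: ae_ge0_le_integral => //.
- by move=> x _; rewrite lee_fin.
- exact/measurable_EFinP.
- by move=> x _; rewrite mule_ge0// normsq2_ge0.
- by apply: measurable_funeM; exact: measurable_normsq2_row.
apply: filterS ae_row_L2 => x hx _; rewrite -(fine_normsq2K hx) -EFinM lee_fin.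
exact: Fk.
Qed.

Lemma hs_op_inner f x : hs_op k f x = inner2 mu setT (row x) (fun y => (f y)^*%C).
Proof. by apply: eq_integralC => y _; rewrite conjcK. Qed.

Lemma hs_op_bound f : L2T f ->
  (normsq2 mu setT (hs_op k f) <=
    (fine (normsq2 mu2 setT k) * fine (normsq2 mu setT f))%:E)%E.
Proof.
move=> hf; rewrite mulrC; apply: integral_le_rows.
- by rewrite fine_ge0// normsq2_ge0.
- by apply: measurable_funC_normsq; apply: measurable_hs_op => //; case: hf.
- by move=> x; rewrite sqr_ge0.
move=> x hx; rewrite hs_op_inner.
have := @cauchy_schwarz _ _ H _ _ (hx : hdom H (row x)) (L2J measurableT hf : hdom H _).
rewrite !hsq_normsq2 mulrC => /le_trans; apply; rewrite le_eqVlt; apply/orP; left.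
apply/eqP; congr (fine _ * _); apply: eq_integral => y _.
by rewrite normcJE.
Qed.

Lemma hs_op_L2 f : L2T f -> L2T (hs_op k f).
Proof.
move=> hf; split; first by apply: measurable_hs_op => //; case: hf.
by apply: le_lt_trans (hs_op_bound hf) _; rewrite ltry.
Qed.

(** At fixed [x], the value of the image of [e i] is the coefficient of the row along the conjugate
    of [e i]. Bessel's inequality for the conjugate family bounds the sum by the square of the row,
    which is then integrated over [x]. *)
Lemma hs_op_bessel (e : nat -> T -> R[i]^o) n : orthonormal_upto H e n ->
  \sum_(i < n) fine (normsq2 mu setT (hs_op k (e i))) <= fine (normsq2 mu2 setT k).
Proof.
move=> [De Oe].
have mKe i : (i < n)%N -> measurable_funC setT (hs_op k (e i)).
  by move=> /De[me _]; exact: measurable_hs_op.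
rewrite -lee_fin -sumEFin.
rewrite (eq_bigr (fun i : 'I_n => (\int[mu]_x ((Normc.normc (hs_op k (e i) x)) ^+ 2)%:E)%E)); last first.
  by move=> i _; rewrite fine_normsq2K//; apply: hs_op_L2; exact: De.
pose F := fun x => \sum_(i < n) Normc.normc (hs_op k (e i) x) ^+ 2.
rewrite -ge0_integral_sum//; last 2 first.
  by move=> i; apply/measurable_EFinP; apply: measurable_funC_normsq; exact: mKe.
  by move=> i x _; rewrite lee_fin sqr_ge0.
rewrite (eq_integral (fun x => (F x)%:E)); last by move=> x _; rewrite /F sumEFin.
rewrite -[leRHS]mul1e -EFinM; apply: integral_le_rows => //.
- by apply: measurable_sum => i; apply: measurable_funC_normsq; exact: mKe.
- by move=> x; rewrite sumr_ge0// => i _; rewrite sqr_ge0.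
move=> x hx; rewrite mul1r.
pose ec i : T -> R[i]^o := fun y => (e i y)^*%C.
have Oec : orthonormal_upto H ec n.
  split=> [i ii|i j ii jj]; first exact: (L2J measurableT (De i ii)).
  rewrite eq_sym -(Oe _ _ jj ii); apply: eq_integralC => y _.
  by rewrite conjcK mulrC.
have := bessel Oec (hx : hdom H (row x)); rewrite hsq_normsq2; apply: le_trans.
by rewrite le_eqVlt; apply/orP; left; apply/eqP; apply: eq_bigr => i _; rewrite hs_op_inner.
Qed.

(** Linearity can fail at those [x] whose row is not square integrable, where the integrals may be
    default values. *)
Lemma hs_opP (a : R[i]) (f g : T -> R[i]^o) : L2T f -> L2T g ->
  ae_eqC mu setT (hs_op k (a *: f + g)) (a *: (hs_op k f : T -> R[i]^o) + hs_op k g).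
Proof.
move=> hf hg; apply: filterS ae_row_L2 => x hx _.
have i1 := L2_mul measurableT hx hf; have i2 := L2_mul measurableT hx hg.
rewrite [RHS](_ : _ = a * hs_op k f x + hs_op k g x)//.
rewrite /hs_op -integralCZ// -integralCD//; last exact: integrableCZ.
by apply: eq_integralC => y _; rewrite mulrCA -mulrDr.
Qed.

End kernel.

Lemma L2_swap k : L2 mu2 setT k -> L2 mu2 setT (fun p => k (p.2, p.1)).
Proof.
move=> [mk fk]; have mk' := measurable_funC_swap mk; split => //.
have mk2 : measurable_fun setT (fun p => ((Normc.normc (k p)) ^+ 2)%:E).
  by apply/measurable_EFinP; exact: measurable_funC_normsq.
have mk2' : measurable_fun setT (fun p => ((Normc.normc (k (p.2, p.1))) ^+ 2)%:E).
  apply/measurable_EFinP.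
  exact: (measurable_funC_normsq (f := fun p : T * T => k (p.2, p.1))).
move: fk; rewrite /normsq2 (fubini_tonelli1 _ mk2)//; last first.
  by move=> p; rewrite lee_fin sqr_ge0.
by rewrite (fubini_tonelli2 _ mk2')// => p; rewrite lee_fin sqr_ge0.
Qed.

(** The transpose appears instead of the adjoint because nothing is conjugated. Fubini applies since
    the integrand is the product of [k] and [f(y) g(x)], both square integrable for the product
    measure. *)
Lemma hs_op_transpose k f g : L2 mu2 setT k -> L2T f -> L2T g ->
  integralC mu setT (fun x => hs_op k f x * g x) =
  integralC mu setT (fun y => f y * hs_op (fun p => k (p.2, p.1)) g y).
Proof.
move=> hk hf hg; have [mf _] := hf; have [mg _] := hg; have [mk _] := hk.
pose F p := k p * (f p.2 * g p.1).
have fgL2 : L2 mu2 setT (fun p => f p.2 * g p.1).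
  have mfg : measurable_funC setT (fun p : T * T => f p.2 * g p.1).
    by apply: measurable_funCM; [exact: measurable_funC_snd|exact: measurable_funC_fst].
  split=> //; rewrite /normsq2 fubini_tonelli1; last 2 first.
    by apply/measurable_EFinP; exact: measurable_funC_normsq.
    by move=> p; rewrite lee_fin sqr_ge0.
  have mf2 : measurable_fun setT (fun x => ((Normc.normc (f x)) ^+ 2)%:E).
    by apply/measurable_EFinP; exact: measurable_funC_normsq.
  have mg2 : measurable_fun setT (fun x => ((Normc.normc (g x)) ^+ 2)%:E).
    by apply/measurable_EFinP; exact: measurable_funC_normsq.
  rewrite (eq_integral (fun x => (normsq2 mu setT f * ((Normc.normc (g x)) ^+ 2)%:E)%E)).
    rewrite -(fine_normsq2K hf) ge0_integralZl//; last 2 first.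
      by move=> x _; rewrite lee_fin sqr_ge0.
      by rewrite lee_fin fine_ge0// normsq2_ge0.
    by rewrite -/(normsq2 mu setT g) -(fine_normsq2K hg) -EFinM ltry.
  move=> x _; rewrite /fubini_F /= muleC.
  rewrite -ge0_integralZl//; last 2 first.
    by move=> y _; rewrite lee_fin sqr_ge0.
    by rewrite lee_fin sqr_ge0.
  by apply: eq_integral => y _; rewrite Normc.normcM exprMn mulrC EFinM.
have iF : integrableC mu2 setT F by exact: L2_mul.
have mF : measurable_funC setT F by apply: measurable_funCM => //; case: fgL2.
have mF' : measurable_funC setT (fun p : T * T => F (p.2, p.1)) by exact: measurable_funC_swap.
have m1 : measurable_funC setT (fun x => integralC mu setT (fun y => F (x, y))).
  case: mF => rF jF; split.
    exact: (measurable_Rintegral_section (h := fun p : T * T => Re (F p))).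
  exact: (measurable_Rintegral_section (h := fun p : T * T => Im (F p))).
have m2 : measurable_funC setT (fun y => integralC mu setT (fun x => F (x, y))).
  case: mF' => rF jF; split.
    exact: (measurable_Rintegral_section (h := fun p : T * T => Re (F (p.2, p.1)))).
  exact: (measurable_Rintegral_section (h := fun p : T * T => Im (F (p.2, p.1)))).
rewrite (@ae_eq_integralC _ _ _ _ _ measurableT _
    (fun x => integralC mu setT (fun y => F (x, y))))//; last 2 first.
- by apply: measurable_funCM => //; exact: measurable_hs_op.
- apply: filterS (ae_row_L2 hk) => x hx _.
  rewrite mulrC /hs_op -integralCZ//; last exact: L2_mul.
  by apply: eq_integralC => y _; rewrite /F/=; ring.
rewrite fubini_integralC//; apply: ae_eq_integralC => //.
  apply: measurable_funCM => //; apply: measurable_hs_op => //.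
  exact: measurable_funC_swap.
apply: filterS (ae_row_L2 (L2_swap hk)) => y hy _.
rewrite /hs_op -integralCZ//; last exact: (L2_mul measurableT hy hg).
by apply: eq_integralC => x _; rewrite /F/=; ring.
Qed.

End hilbert_schmidt.

(** * Lower bound for the identity plus a Hilbert-Schmidt operator *)

Section hs_bounded_below.
Context (R : realType) (d : measure_display) (T : measurableType d).
Variable mu : {sigma_finite_measure set T -> \bar R}.
Local Notation L2T := (L2 mu setT).
Local Notation H := (L2_hilbert mu measurableT).
Local Notation E := (T -> R[i]^o).

Lemma hnorm_ae (f g : E) : L2T f -> L2T g -> ae_eqC mu setT f g -> hnorm H f = hnorm H g.
Proof.
move=> [mf _] [mg _] fg; rewrite /hnorm !hsq_normsq2; congr (Num.sqrt (fine _)).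
exact: ae_eq_normsq2.
Qed.

Lemma hs_op_bounded_below (k : T * T -> R[i]) : L2 (mu \x mu)%E setT k ->
  (forall f : E, L2T f -> ae_eqC mu setT (f + hs_op mu k f) (fun=> 0) ->
     ae_eqC mu setT f (fun=> 0)) ->
  exists2 c : R, 0 < c &
    forall f : E, L2T f -> c * hnorm H f <= hnorm H (f + hs_op mu k f).
Proof.
move=> kL2 inj; pose B := fine (normsq2 (mu \x mu)%E setT k).
pose N (f : E) := hnorm H (f + hs_op mu k f).
have B0 : 0 <= B by rewrite fine_ge0// normsq2_ge0.
have hK (f : E) : L2T f -> L2T (hs_op mu k f) by exact: hs_op_L2.
have hIK (f : E) : L2T f -> L2T (f + hs_op mu k f).
  by move=> hf; apply: (@hdomD _ _ H) => //; exact: hK.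
have hKB (f : E) : L2T f -> hnorm H (hs_op mu k f) <= Num.sqrt B * hnorm H f.
  move=> hf; rewrite /hnorm !hsq_normsq2 -sqrtrM// ler_wsqrtr//.
  by rewrite -lee_fin fine_normsq2K ?hs_op_bound//; exact: hK.
(* The norm ignores null sets, so linearity almost everywhere is enough to make [N] a seminorm. *)
have NP (a : R[i]) (f g : E) : L2T f -> L2T g ->
    N (a *: f + g) = hnorm H (a *: (f + hs_op mu k f) + (g + hs_op mu k g)).
  move=> hf hg; have hafg : L2T (a *: f + g) by exact: (@hdomP _ _ H).
  apply: hnorm_ae; [exact: hIK|by apply: (@hdomP _ _ H); exact: hIK|].
  apply: filterS (hs_opP kL2 a hf hg) => x /(_ I) hx _.
  rewrite [LHS](_ : _ = (a *: f + g) x + hs_op mu k (a *: f + g) x)// hx.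
  by rewrite scalerDr addrACA.
have ND (f g : E) : L2T f -> L2T g -> N (f + g) <= N f + N g.
  move=> hf hg; rewrite -[f in N (f + g)]scale1r NP// scale1r.
  by apply: (@ler_hnormD _ _ H); exact: hIK.
have NZ (a : R[i]) (f : E) : L2T f -> N (a *: f) = Normc.normc a * N f.
  move=> hf; have h0 : L2T (0 : E) by exact: (@hdom0 _ _ H).
  rewrite -[a *: f]addr0 NP// add0r -hnormZ; last exact: hIK.
  have hz : L2T (a *: (f + hs_op mu k f)) by apply: (@hdomZ _ _ H); exact: hIK.
  apply: hnorm_ae => //; first by apply: (@hdomD _ _ H) => //; exact: hK.
  apply: aeW => x _; rewrite [LHS](_ : _ = (a *: (f + hs_op mu k f)) x + hs_op mu k 0 x)//.
  rewrite [X in _ + X](_ : _ = 0) ?addr0// /hs_op.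
  rewrite (_ : integralC _ _ _ = integralC mu setT (fun=> 0)).
    by rewrite /integralC/= !Rintegral_cst//= !mul0r.
  by apply: eq_integralC => y _; rewrite mulr0.
have NC (f : E) : L2T f -> N f <= (1 + Num.sqrt B) * hnorm H f.
  move=> hf; apply: (le_trans (@ler_hnormD _ _ H _ _ hf (hK _ hf))).
  by rewrite mulrDl mul1r lerD2l hKB.
have N0 (f : E) : L2T f -> N f = 0 -> hsq H f = 0.
  move=> hf Nf; rewrite hsq_normsq2 ae_normsq2_eq0//; first by case: hf.
  apply: inj => //; have [mIK fIK] := hIK _ hf; apply: normsq2_eq0 => //.
  rewrite -(@hsq_normsq2 _ _ _ _ _ measurableT) -sqr_hnorm; last exact: hIK.
  by rewrite [hnorm H _]Nf expr0n.
(* If [N (e i) <= 1/2], the image of the unit vector [e i] has norm at least 1/2. Each vector thus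
   takes at least 1/4 of a Bessel sum bounded by [B], whence [n <= 4 B]. *)
have bes (e : nat -> E) n : orthonormal_upto H e n ->
    (forall i, (i < n)%N -> N (e i) <= 2^-1) -> (n <= Num.truncn (4 * B))%N.
  move=> He Ne; have [De Oe] := He.
  have Ke i : (i < n)%N -> 4^-1 <= fine (normsq2 mu setT (hs_op mu k (e i))).
    move=> ii; have Dei := De i ii; have nei : hnorm H (e i) = 1.
      by rewrite /hnorm /hsq Oe// eqxx sqrtr1.
    have : 2^-1 <= hnorm H (hs_op mu k (e i)).
      have : hnorm H (e i) <= N (e i) + hnorm H (hs_op mu k (e i)).
        rewrite -[e i in X in X <= _](addrK (hs_op mu k (e i))).
        by apply: (@ler_hnormB _ _ H); [exact: hIK|exact: hK].
      have := Ne i ii; rewrite nei; lra.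
    move=> h; rewrite -(@hsq_normsq2 _ _ _ _ _ measurableT) -sqr_hnorm; last exact: hK.
    have -> : 4^-1 = 2^-1 ^+ 2 :> R by field.
    by rewrite ler_pXn2r// nnegrE// hnorm_ge0.
  rewrite truncn_ge_nat; last by rewrite mulr_ge0.
  have := hs_op_bessel kL2 He; rewrite -/B => h.
  have : \sum_(i < n) (4^-1 : R) <= B by apply: le_trans h; apply: ler_sum => i _; exact: Ke.
  rewrite sumr_const card_ord -mulr_natl; lra.
exact: (@bounded_below_of_bessel _ _ H N _ ND NZ NC N0 _ bes).
Qed.

End hs_bounded_below.

(** * Eigenfunction expansion of a bounded kernel *)

Section kernel_expansion.
Context (R : realType) (d : measure_display) (T : measurableType d).
Variable m : {finite_measure set T -> \bar R}.
Variable D : set T.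
Hypothesis mD : measurable D.
Local Notation H := (L2_hilbert m mD).
Local Notation E := (T -> R[i]^o).

Let mDD : measurable (D `*` D). Proof. exact: measurableX. Qed.

Lemma patch_setX (h : T * T -> \bar R) x :
  (\int[m]_y (h \_ (D `*` D)) (x, y) =
   ((fun x => \int[m]_(y in D) h (x, y)) \_ D) x)%E.
Proof.
rewrite /patch; case: ifPn => Dx.
  rewrite [RHS]integral_mkcond; apply: eq_integral => y _.
  rewrite /patch in_setX /= Dx.
  by case: (boolP (y \in D)) => Dy; rewrite ?Dx ?Dy.
rewrite integral0_eq// => y _.
by rewrite in_setX /= (negbTE Dx).
Qed.

(** Extension by zero outside [D x D] reduces this to Tonelli on the whole product. *)
Lemma tonelli_setX (h : T * T -> \bar R) : measurable_fun (D `*` D) h ->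
  (forall p, (D `*` D) p -> (0 <= h p)%E) ->
  measurable_fun D (fun x => \int[m]_(y in D) h (x, y))%E /\
  (\int[m \x m]_(p in D `*` D) h p = \int[m]_(x in D) \int[m]_(y in D) h (x, y))%E.
Proof.
move=> mh h0; have /(measurable_restrictT _ mDD) mh' := mh.
have h0' p : (0 <= (h \_ (D `*` D)) p)%E.
  by rewrite /patch; case: ifPn => // /set_mem; exact: h0.
have e : fubini_F m (h \_ (D `*` D)) = (fun x => \int[m]_(y in D) h (x, y))%E \_ D.
  by apply/funext => x; exact: patch_setX.
split.
  apply/(measurable_restrictT _ mD); rewrite -e.
  exact: measurable_fun_fubini_tonelli_F.
rewrite integral_mkcond fubini_tonelli1// e [RHS]integral_mkcond.
by [].
Qed.

Lemma measurable_funC_row (F : T * T -> R[i]) x : D x ->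
  measurable_funC (D `*` D) F -> measurable_funC D (fun y => F (x, y)).
Proof.
have mp : measurable_fun D (pair x : T -> T * T).
  by apply: (measurable_funS measurableT) => //; exact: measurable_pair1.
by move=> Dx [rF jF]; split; [move: rF|move: jF] => mF;
  apply: (measurable_comp mDD _ mF mp) => _ [y Dy <-].
Qed.

Lemma bounded_L2 (f : T -> R[i]) (M : R) : measurable_funC D f ->
  (forall x, D x -> Normc.normc (f x) ^+ 2 <= M) ->
  L2 m D f /\ (normsq2 m D f <= M%:E * m D)%E.
Proof.
move=> mf fM.
have b : (normsq2 m D f <= M%:E * m D)%E.
  rewrite -integral_cst//; apply: ge0_le_integral => //.
  - by move=> x _; rewrite lee_fin sqr_ge0.
  - by apply/measurable_EFinP; exact: measurable_funC_normsq.
split => //; split => //; apply: le_lt_trans b _.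
rewrite -[m D]fineK ?fin_num_measure// -EFinM; exact: ltry.
Qed.

Variables (F : T * T -> R[i]) (M : R) (G : nat -> T -> R[i]) (a : nat -> R[i]).
Hypothesis mF : measurable_funC (D `*` D) F.
Hypothesis FM : forall p, (D `*` D) p -> Normc.normc (F p) ^+ 2 <= M.
Hypothesis G_complete : complete_orthonormal m D G.
Hypothesis F_eigen : forall j, {ae m, forall x, D x ->
  integralC m D (fun y => F (x, y) * G j y) = a j * G j x}.

(** The conjugation in the inner product cancels this one: the coefficient of [F (x, .)] along
    [GJ j] is the integral of [F_eigen]. *)
Let GJ j : E := fun y => (G j y)^*%C.

Let GJ_on n : orthonormal_upto H GJ n.
Proof.
have [[GL2 Gon] _] := G_complete; split=> [i _|i j _ _].
  exact: (L2J mD (GL2 i)).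
rewrite eq_sym -Gon; apply: eq_integralC => y _.
by rewrite conjcK mulrC.
Qed.

Let GJ_total (g : E) : hdom H g -> (forall j, ip H g (GJ j) = 0) -> hsq H g = 0.
Proof.
have [[GL2 _] Gtot] := G_complete.
move=> hg gG; rewrite hsq_normsq2 ae_normsq2_eq0//; first by case: (hg).
have hgJ : L2 m D (fun y => (g y)^*%C) by exact: L2J.
have := Gtot _ hgJ; have gJ j : inner2 m D (fun y => (g y)^*%C) (G j) = 0.
  rewrite -[RHS](conjc0 R) -(gG j) -integralCJ//; last first.
    by apply: L2_inner => //; exact: L2J.
  by apply: eq_integralC => y _; rewrite conjcM /GJ conjcK.
move=> /(_ gJ); apply: filterS => y hy Dy.
by have /(congr1 (@conjc R)) := hy Dy; rewrite conjcK conjc0.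
Qed.

Let residual n : T * T -> R[i] :=
  fun p => F p - \sum_(j < n) a j * G j p.1 * (G j p.2)^*%C.

Let mG j : measurable_funC D (G j).
Proof. by have [[GL2 _] _] := G_complete; case: (GL2 j). Qed.

Let m_fst (f : T -> R[i]) : measurable_funC D f ->
  measurable_funC (D `*` D) (fun p => f p.1).
Proof.
have mp : measurable_fun (D `*` D) (fst : T * T -> T) by exact: measurable_funTS.
by move=> [rf jf]; split; [move: rf|move: jf] => mf;
  apply: (measurable_comp mD _ mf mp) => _ [[x y] [Dx Dy] <-].
Qed.

Let m_snd (f : T -> R[i]) : measurable_funC D f ->
  measurable_funC (D `*` D) (fun p => f p.2).
Proof.
have mp : measurable_fun (D `*` D) (snd : T * T -> T) by exact: measurable_funTS.
by move=> [rf jf]; split; [move: rf|move: jf] => mf;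
  apply: (measurable_comp mD _ mf mp) => _ [[x y] [Dx Dy] <-].
Qed.

Let m_residual n : measurable_funC (D `*` D) (residual n).
Proof.
rewrite /residual; elim: n => [|n IH].
  by under eq_fun do rewrite big_ord0 subr0.
under eq_fun do rewrite big_ord_recr opprD addrA.
apply: (measurable_funCD IH).
have := measurable_funCM (measurable_funC_cst (D `*` D) (- a n))
  (measurable_funCM (m_fst (mG n)) (m_snd (measurable_funCJ (mG n)))).
by under eq_fun do rewrite mulNr mulrA.
Qed.

Lemma kernel_L2 : L2 (m \x m)%E (D `*` D) F.
Proof.
split=> //; rewrite /normsq2.
have mF2 : measurable_fun (D `*` D) (fun p => ((Normc.normc (F p)) ^+ 2)%:E).
  by apply/measurable_EFinP; exact: measurable_funC_normsq.
apply: (@le_lt_trans _ _ (\int[m \x m]_(p in D `*` D) (cst M%:E p))%E).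
  apply: ge0_le_integral => //.
  - by move=> x _; rewrite lee_fin sqr_ge0.
rewrite integral_cst//.
rewrite [X in (_ * X)%E](_ : _ = (fine (m D) * fine (m D))%:E).
  by rewrite -EFinM ltry.
transitivity (m D * m D)%E; first exact: product_measure1E.
by rewrite EFinM fineK// fin_num_measure.
Qed.

Let residual_row n x : {in D, (fun y => residual n (x, y)) =1
  (((fun y => F (x, y)) : E) - \sum_(j < n) (a j * G j x) *: GJ j)}.
Proof.
move=> y _; rewrite /residual [RHS](_ : _ = F (x, y) - (\sum_(j < n) (a j * G j x) *: GJ j) y)//.
by rewrite fct_sumE.
Qed.

(** The exceptional sets of the countably many relations [F_eigen] have a null union. Off it, all
    partial sums of the expansion are at once projections of the row. *)
Let row_props : {ae m, forall x, D x ->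
  [/\ L2 m D (fun y => F (x, y)),
      (normsq2 m D (fun y => F (x, y)) <= M%:E * m D)%E &
      forall n, normsq2 m D (fun y => residual n (x, y)) =
        (hsq H (((fun y => F (x, y)) : E) - proj H GJ n (fun y => F (x, y))))%:E]}.
Proof.
have : {ae m, forall x, forall j, D x ->
  integralC m D (fun y => F (x, y) * G j y) = a j * G j x}.
  exact/ae_foralln.
apply: filterS => x hx Dx.
have [h1 h2] : L2 m D (fun y => F (x, y)) /\ (normsq2 m D (fun y => F (x, y)) <= M%:E * m D)%E.
  by apply: bounded_L2; [exact: measurable_funC_row|move=> y Dy; exact: FM].
split=> // n; rewrite hsq_normsq2.
have e : proj H GJ n (fun y => F (x, y)) = \sum_(j < n) (a j * G j x) *: GJ j.
  apply: eq_bigr => j _; congr (_ *: _); rewrite -hx//.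
  by apply: eq_integralC => y _; rewrite conjcK.
have hr : L2 m D (((fun y => F (x, y)) : E) - proj H GJ n (fun y => F (x, y))).
  by apply: (@hdomB _ _ H) => //; apply: hdom_proj; exact: GJ_on.
rewrite fine_normsq2K// e; apply: eq_integral => y Dy.
by rewrite residual_row.
Qed.

Lemma kernel_expansion :
  (fun n => normsq2 (m \x m)%E (D `*` D) (residual n)) @ \oo --> 0%E.
Proof.
pose f n x := normsq2 m D (fun y => residual n (x, y)).
have mr2 n : measurable_fun (D `*` D) (fun p => ((Normc.normc (residual n p)) ^+ 2)%:E).
  by apply/measurable_EFinP; exact: measurable_funC_normsq.
have r0 n p : (D `*` D) p -> (0 <= ((Normc.normc (residual n p)) ^+ 2)%:E)%E.
  by move=> _; rewrite lee_fin sqr_ge0.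
have mf n : measurable_fun D (f n) by have [] := tonelli_setX (mr2 n) (r0 n).
have -> : (fun n => normsq2 (m \x m)%E (D `*` D) (residual n)) =
    (fun n => \int[m]_(x in D) f n x)%E.
  by apply/funext => n; have [_] := tonelli_setX (mr2 n) (r0 n).
(* The dominating function is constant, and integrable because [m] is finite: a residual has at most
   the square of the row, which is at most [M * m D]. *)
have [] := @dominated_convergence _ _ _ m D mD f (fun=> 0%E) (fun=> (M%:E * m D)%E) mf.
- exact: measurable_cst.
- apply: filterS row_props => x hx Dx; have [hF _ e] := hx Dx.
  have := parseval GJ_on GJ_total (hF : hdom H (fun y => F (x, y))) => par.
  rewrite (_ : f ^~ x = fun n => (hsq H
    (((fun y => F (x, y)) : E) - proj H GJ n (fun y => F (x, y))))%:E); last exact/funext/e.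
  by apply: cvg_EFin => //; exact: nearW.
- have -> : (M%:E * m D)%E = (M * fine (m D))%:E by rewrite EFinM fineK// fin_num_measure.
  exact: finite_measure_integrable_cst.
- apply: filterS row_props => x hx n Dx; have [hF FMx e] := hx Dx.
  rewrite gee0_abs ?normsq2_ge0// /f e; apply: le_trans FMx.
  rewrite -(fine_normsq2K hF) lee_fin hsq_residual// hsq_normsq2.
  by rewrite gerBl sumr_ge0// => i _; rewrite sqr_ge0.
by rewrite integral0.
Qed.

End kernel_expansion.

(** * Measurability on R3 and on the sphere *)

Section uniform_measurable.
Context (R : realType).

(** A countable measurable stand-in for a base of the topology. It passes to products, and so suits
    the product sigma-algebras of [R3] and [R3 x R3]. *)
Definition small_cover (d : measure_display) (T : measurableType d)
    (near : R -> T -> T -> Prop) :=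
  exists B : nat -> set T, (forall i, measurable (B i)) /\
    forall (delta : R) (p : T), 0 < delta ->
      exists i, B i p /\ forall q, B i q -> near delta p q.

Lemma small_coverR : @small_cover _ (measurableTypeR R)
  (fun delta x y => `|x - y : R| <= delta).
Proof.
pose C (kn : int * nat) : set (measurableTypeR R) :=
  `[kn.1%:~R / kn.2.+1%:R, (kn.1 + 1)%:~R / kn.2.+1%:R[%classic.
exists (fun i => if unpickle i is Some kn then C kn else set0); split.
  by move=> i; case: unpickle => // kn; exact: measurable_itv.
move=> delta p d0; pose n := Num.truncn delta^-1.
have n0 : 0 < n.+1%:R :> R by rewrite ltr0n.
have nd : n.+1%:R^-1 <= delta.
  rewrite -[leRHS]invrK lef_pV2 ?posrE ?invr_gt0//.
  exact/ltW/Num.Theory.truncnS_gt.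
exists (pickle (Num.floor (p * n.+1%:R), n)); rewrite pickleK; split.
  rewrite /C /= in_itv/= ler_pdivrMr// ltr_pdivlMr//.
  by rewrite Num.Theory.floor_le_tmp Num.Theory.floorD1_gt.
move=> q; rewrite /C /= in_itv/= ler_pdivrMr// ltr_pdivlMr// => /andP[q1 q2].
have p1 : (Num.floor (p * n.+1%:R))%:~R <= p * n.+1%:R by exact: Num.Theory.floor_le_tmp.
have p2 : p * n.+1%:R < (Num.floor (p * n.+1%:R) + 1)%:~R by exact: Num.Theory.floorD1_gt.
apply: le_trans nd; rewrite -[leRHS]mul1r ler_pdivlMr// -[X in _ * X](gtr0_norm n0).
rewrite -normrM mulrBl ler_norml.
by move: q2 p2; rewrite intrD; lra.
Qed.

Lemma small_cover_prod (d1 d2 : measure_display) (T1 : measurableType d1)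
    (T2 : measurableType d2) (near1 : R -> T1 -> T1 -> Prop) (near2 : R -> T2 -> T2 -> Prop) :
  small_cover near1 -> small_cover near2 ->
  small_cover (fun delta (p q : T1 * T2) => near1 delta p.1 q.1 /\ near2 delta p.2 q.2).
Proof.
move=> [B1 [m1 c1]] [B2 [m2 c2]].
exists (fun i => if unpickle i is Some ij then B1 ij.1 `*` B2 ij.2 else set0); split.
  by move=> i; case: unpickle => // ij; exact: measurableX.
move=> delta [p1 p2] d0; have [i [Bi ni]] := c1 _ p1 d0; have [j [Bj nj]] := c2 _ p2 d0.
exists (pickle (i, j)); rewrite pickleK; split => //.
by move=> [q1 q2] [/= /ni ? /nj].
Qed.

(** The part of [D] where [h > t] is the countable union of the traces [D & B i] that it contains:
    around a point [p] of it, variations below [(h p - t) / 2] keep [h] above [t]. *)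
Lemma uniformly_continuous_measurable (d : measure_display) (T : measurableType d)
    (near : R -> T -> T -> Prop) (D : set T) (h : T -> R) :
  small_cover near -> measurable D ->
  (forall eps : R, 0 < eps -> exists2 delta : R, 0 < delta &
     forall p q, D p -> D q -> near delta p q -> `|h p - h q| <= eps) ->
  measurable_fun D h.
Proof.
move=> [B [mB cB]] mD hu.
apply: (measurability _ (RGenOInfty.measurableE R)).
move=> _ [_ [t ->] <-].
rewrite (_ : D `&` _ = \bigcup_i (if `[< D `&` B i `<=` [set p | t < h p] >]
    then D `&` B i else set0)); last first.
  apply/seteqP; split => [p [Dp]|p [i _]]; last first.
    case: ifPn => // /asboolP sub [Dp Bp]; split => //=.
    by rewrite in_itv/= andbT; apply: sub.
  rewrite /= in_itv/= andbT => tp.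
  have e0 : 0 < (h p - t) / 2 by rewrite divr_gt0// subr_gt0.
  have [delta d0 hd] := hu _ e0; have [i [Bp ni]] := cB _ p d0.
  exists i => //; rewrite ifT//; apply/asboolP => q [Dq Bq] /=.
  have := hd p q Dp Dq (ni q Bq); rewrite ler_norml => /andP[_]; lra.
by apply: bigcup_measurable => i _; case: ifPn => // _; exact: measurableI.
Qed.

End uniform_measurable.

(** * Modulus of continuity of the complex exponential *)

Section trigonometry.
Context (R : realType).
Implicit Types a b x : R.

Lemma norm_sin_le x : `|sin x| <= `|x|.
Proof.
wlog x0 : x / 0 <= x.
  move=> h; have [/h//|/ltW x0] := leP 0 x.
  by rewrite -normrN -sinN -[`|x|]normrN; apply: h; rewrite oppr_ge0.
have [c _] : exists2 c, c \in `[0, x]%R & sin x - sin 0 = cos c * (x - 0).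
  apply: MVT_segment => //; apply: continuous_subspaceT; exact: continuous_sin.
rewrite sin0 !subr0 => ->; rewrite normrM -[leRHS]mul1r.
by apply: ler_wpM2r => //; exact: cos_max.
Qed.

Lemma normc_cis a : Normc.normc (cis a) = 1.
Proof. by rewrite /cis/= cos2Dsin2 sqrtr1. Qed.

Lemma cisN a : cis (- a) = (cis a)^*%C.
Proof. by rewrite /cis cosN sinN. Qed.

Lemma normc_cisB a b : Normc.normc (cis a - cis b) ^+ 2 = 4 * sin ((a - b) / 2) ^+ 2.
Proof.
rewrite sqr_normcE /=.
have -> : (cos a - cos b) ^+ 2 + (sin a - sin b) ^+ 2 = 2 - 2 * cos (a - b).
  rewrite cosB; have := cos2Dsin2 a; have := cos2Dsin2 b; lra.
have {1}-> : a - b = (a - b) / 2 *+ 2 by rewrite mulr2n; field.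
rewrite cos_mulr2n sin2cos2; ring.
Qed.

(** Of the two bounds, the quadratic one gives pointwise convergence and the constant one an
    integrable majorant. *)
Lemma normc_cisB_le a b : Normc.normc (cis a - cis b) ^+ 2 <= Num.min 4 ((a - b) ^+ 2).
Proof.
rewrite normc_cisB le_min; apply/andP; split.
  suff : sin ((a - b) / 2) ^+ 2 <= 1 by lra.
  rewrite -(real_normK (num_real (sin _))).
  by rewrite expr_le1//; exact: sin_max.
have -> : (a - b) ^+ 2 = 4 * ((a - b) / 2) ^+ 2 by field.
rewrite ler_wpM2l// -(real_normK (num_real (sin _))) -(real_normK (num_real ((a - b) / 2))).
by rewrite ler_pXn2r ?nnegrE//; exact: norm_sin_le.
Qed.

End trigonometry.

(** * Measurability of the vector operations *)

Section measurable_R3.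
Context (R : realType) (d : measure_display) (T : measurableType d).
Implicit Types (h : T -> R3 R).

Lemma measurable_crd1 h : measurable_fun setT h -> measurable_fun setT (fun x => crd1 (h x)).
Proof.
move=> mh; exact: (measurableT_comp measurable_fst (measurableT_comp measurable_fst mh)).
Qed.

Lemma measurable_crd2 h : measurable_fun setT h -> measurable_fun setT (fun x => crd2 (h x)).
Proof.
move=> mh; exact: (measurableT_comp measurable_snd (measurableT_comp measurable_fst mh)).
Qed.

Lemma measurable_crd3 h : measurable_fun setT h -> measurable_fun setT (fun x => crd3 (h x)).
Proof. by move=> mh; exact: (measurableT_comp measurable_snd mh). Qed.

Lemma measurable_dot3 h h' : measurable_fun setT h -> measurable_fun setT h' ->
  measurable_fun setT (fun x => dot3 (h x) (h' x)).
Proof.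
move=> mh mh'; apply: measurable_funD; first apply: measurable_funD.
- by apply: measurable_funM; exact: measurable_crd1.
- by apply: measurable_funM; exact: measurable_crd2.
- by apply: measurable_funM; exact: measurable_crd3.
Qed.

Lemma measurable_norm3 h : measurable_fun setT h ->
  measurable_fun setT (fun x => norm3 (h x)).
Proof.
move=> mh; apply: (measurableT_comp (f := @Num.sqrt R)).
  by apply: continuous_measurable_fun; exact: sqrt_continuous.
exact: measurable_dot3.
Qed.

Lemma measurable_sub3 h h' : measurable_fun setT h -> measurable_fun setT h' ->
  measurable_fun setT (fun x => sub3 (h x) (h' x)).
Proof.
have toR (f : T -> R) : measurable_fun setT f ->
    measurable_fun setT (f : T -> measurableTypeR R).
  by move=> mf _ Y mY; exact: (mf measurableT Y mY).
move=> mh mh'; apply: measurable_fun_pair; first apply: measurable_fun_pair; apply: toR.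
- by apply: measurable_funB; exact: measurable_crd1.
- by apply: measurable_funB; exact: measurable_crd2.
- by apply: measurable_funB; exact: measurable_crd3.
Qed.

Lemma measurable_cis (f : T -> R) : measurable_fun setT f ->
  measurable_funC setT (fun x => cis (f x)).
Proof.
by move=> mf; split; apply: measurableT_comp mf;
  apply: continuous_measurable_fun; [exact: continuous_cos|exact: continuous_sin].
Qed.

Lemma measurable_inv_ge0 (f : T -> R) : (forall x, 0 <= f x) -> measurable_fun setT f ->
  measurable_fun setT (fun x => (f x)^-1).
Proof.
move=> f0 mf; rewrite (_ : (fun x => _) = (fun x => f x `^ (-1))).
  exact: (measurableT_comp (measurable_powR _)).
by apply/funext => x; rewrite powR_inv1.
Qed.

Lemma measurable_sg (f : T -> R) : measurable_fun setT f ->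
  measurable_fun setT (fun x => Num.sg (f x)).
Proof.
move=> mf; rewrite (_ : (fun x => _) =
    (fun x => if 0 < f x then 1 else if f x < 0 then -1 else 0)); last first.
  apply/funext => x; case: (ltgtP 0 (f x)) => [h|h|<-]; last by rewrite sgr0.
  - by rewrite gtr0_sg.
  - by rewrite ltr0_sg.
apply: measurable_fun_ifT => //; first exact: measurable_fun_ltr.
by apply: measurable_fun_ifT => //; exact: measurable_fun_ltr.
Qed.

End measurable_R3.

Section sphere.
Context (R : realType).

Lemma measurable_S2 : measurable (@S2 R).
Proof.
have := @measurable_norm3 R _ (R3 R) id (@measurable_id _ _ _).
by move=> /(_ measurableT [set 1] (measurable_set1 _)); rewrite setTI.
Qed.

(** Coordinatewise, in the nested shape that [small_cover_prod] produces. *)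
Definition near3 (delta : R) (p q : R3 R) : Prop :=
  (`|p.1.1 - q.1.1 : R| <= delta /\ `|p.1.2 - q.1.2 : R| <= delta) /\
  `|p.2 - q.2 : R| <= delta.

Lemma small_cover_near3 : small_cover near3.
Proof.
have c := @small_coverR R.
exact: (small_cover_prod (small_cover_prod c c) c).
Qed.

End sphere.

(** * The scattering amplitude *)

Section potential.
Variables (R : realType) (V : R3 R -> R) (l : R).
Local Notation mu3 := (@leb3 R).
Local Notation L2R3 := (L2 mu3 setT).
Local Notation H3 := (L2_hilbert mu3 measurableT).
Local Notation E3 := (R3 R -> R[i]^o).
Hypothesis V_rollnik : rollnik V.
Hypothesis V_L1 : V \in Lfun mu3 1%E.
Hypothesis l_gt0 : 0 < l.

Let mV : measurable_fun setT V. Proof. by case: V_rollnik. Qed.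

Definition inv4pi : R[i] := ((4 * pi)^-1)%:C%C.
Definition plane (w : R3 R) : E3 :=
  fun r => (sqrtV V r)%:C%C * cis (Num.sqrt l * dot3 w r).
Definition opp3 (w : R3 R) := scale3 (-1) w.
Definition bil (f g : E3) : R[i] := integralC mu3 setT (fun r => mulW V f r * g r).
(** The factor [W] of [K] is left out, which makes this kernel symmetric; it comes back through
    [mulW]. *)
Definition green (p : R3 R * R3 R) : R[i] :=
  (sqrtV V p.1)%:C%C
  * (cis (Num.sqrt l * norm3 (sub3 p.1 p.2)) / (norm3 (sub3 p.1 p.2))%:C%C)
  * (sqrtV V p.2)%:C%C.

Lemma sqr_sqrtV r : sqrtV V r ^+ 2 = `|V r|.
Proof. by rewrite sqr_sqrtr. Qed.

Lemma sg_sqrtV r : (Num.sg (V r))%:C%C * (sqrtV V r)%:C%C * (sqrtV V r)%:C%C = (V r)%:C%C.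
Proof. by rewrite -mulrA -!rmorphM/= -expr2 sqr_sqrtV -numEsg. Qed.

Lemma dot3_opp (w r : R3 R) : dot3 (opp3 w) r = - dot3 w r.
Proof. by rewrite /dot3 /opp3 /crd1 /crd2 /crd3 /=; ring. Qed.

Lemma dot3C (w r : R3 R) : dot3 w r = dot3 r w.
Proof. by rewrite /dot3; ring. Qed.

Lemma dot3_scale a (w r : R3 R) : dot3 (scale3 a w) r = a * dot3 w r.
Proof. by rewrite /dot3 /crd1 /crd2 /crd3 /=; ring. Qed.

Lemma norm3_subC (r s : R3 R) : norm3 (sub3 r s) = norm3 (sub3 s r).
Proof. by rewrite /norm3 /dot3 /crd1 /crd2 /crd3 /=; congr Num.sqrt; ring. Qed.

Lemma measurable_sqrtV : measurable_fun setT (sqrtV V).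
Proof.
apply: (measurableT_comp (f := @Num.sqrt R)).
  by apply: continuous_measurable_fun; exact: sqrt_continuous.
exact: measurableT_comp.
Qed.

Lemma measurable_mulW (f : E3) : measurable_funC setT f -> measurable_funC setT (mulW V f).
Proof.
by move=> mf; apply: measurable_funCM => //; apply: measurable_funC_real; exact: measurable_sg.
Qed.

Lemma normc_sg (x : R) : Normc.normc (Num.sg x)%:C%C <= 1.
Proof. by rewrite normc_real normr_sg; case: eqP => _; rewrite ?ler01. Qed.

Lemma normc_mulW (f : E3) r : Normc.normc (mulW V f r) <= Normc.normc (f r).
Proof. by rewrite Normc.normcM ler_piMl ?normc_ge0// normc_sg. Qed.

Lemma mulW_L2 (f : E3) : L2R3 f -> L2R3 (mulW V f).
Proof.
move=> hf; apply: (L2_le measurableT _ _ hf); first by apply: measurable_mulW; case: hf.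
by move=> r _; exact: normc_mulW.
Qed.

Lemma hnorm_le (f g : E3) : L2R3 f -> L2R3 g ->
  (forall r, Normc.normc (f r) <= Normc.normc (g r)) -> hnorm H3 f <= hnorm H3 g.
Proof.
move=> hf hg fg; rewrite /hnorm !hsq_normsq2 ler_wsqrtr//.
rewrite -lee_fin !fine_normsq2K//; apply: ge0_le_integral => //.
- by move=> r _; rewrite lee_fin sqr_ge0.
- by apply/measurable_EFinP; apply: measurable_funC_normsq; case: hf.
- by apply/measurable_EFinP; apply: measurable_funC_normsq; case: hg.
- by move=> r _; rewrite lee_fin ler_pXn2r ?nnegrE ?normc_ge0.
Qed.

Lemma bil_bound (f g : E3) : L2R3 f -> L2R3 g ->
  Normc.normc (bil f g) <= hnorm H3 f * hnorm H3 g.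
Proof.
move=> hf hg; have hgJ : L2R3 (fun r => (g r)^*%C) by exact: L2J.
have -> : bil f g = ip H3 (mulW V f) (fun r => (g r)^*%C).
  by apply: eq_integralC => r _; rewrite conjcK.
apply: (le_trans (@cauchy_schwarz_hnorm _ _ H3 _ _ (mulW_L2 hf) hgJ)).
apply: ler_pM; rewrite ?hnorm_ge0//; apply: hnorm_le => //; first exact: mulW_L2.
- by move=> r; exact: normc_mulW.
- by move=> r; rewrite normcJE.
Qed.

Lemma bilC (f g : E3) : bil f g = bil g f.
Proof. by apply: eq_integralC => r _; rewrite /mulW; ring. Qed.

Lemma bilDl (f g h : E3) : L2R3 f -> L2R3 g -> L2R3 h -> bil (f + g) h = bil f h + bil g h.
Proof.
move=> hf hg hh; rewrite /bil -integralCD//; last 2 first.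
- exact: (L2_mul measurableT (mulW_L2 hf) hh).
- exact: (L2_mul measurableT (mulW_L2 hg) hh).
apply: eq_integralC => r _; rewrite /mulW.
rewrite [X in _ * X * _](_ : _ = f r + g r)//; ring.
Qed.

Lemma bilNl (f h : E3) : L2R3 f -> L2R3 h -> bil (- f) h = - bil f h.
Proof.
move=> hf hh; rewrite /bil -[RHS]mulN1r -integralCZ//; last exact: (L2_mul measurableT (mulW_L2 hf) hh).
apply: eq_integralC => r _; rewrite /mulW.
rewrite [X in _ * X * _](_ : _ = - f r)//; ring.
Qed.

Lemma bil_ae (f g h : E3) : L2R3 f -> L2R3 g -> L2R3 h ->
  ae_eqC mu3 setT f g -> bil f h = bil g h.
Proof.
move=> [mf _] [mg _] [mh _] fg; apply: ae_eq_integralC => //.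
- by apply: measurable_funCM => //; exact: measurable_mulW.
- by apply: measurable_funCM => //; exact: measurable_mulW.
by apply: filterS fg => r hr _; rewrite /mulW hr.
Qed.

Lemma measurable_plane w : measurable_funC setT (plane w).
Proof.
apply: measurable_funCM; first by apply: measurable_funC_real; exact: measurable_sqrtV.
apply: measurable_cis; apply: measurable_funM => //.
by apply: measurable_dot3 => //; exact: measurable_cst.
Qed.

Let iV : mu3.-integrable setT (fun r => `|V r|%:E).
Proof. by have /Lfun1_integrable/integrable_norm := V_L1. Qed.

Definition normV : R := fine (\int[mu3]_r `|V r|%:E)%E.

Lemma normsq2_plane w : normsq2 mu3 setT (plane w) = (\int[mu3]_r `|V r|%:E)%E.
Proof.
apply: eq_integral => r _.
by rewrite Normc.normcM normc_cis mulr1 normc_real real_normK ?num_real// sqr_sqrtV.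
Qed.

Lemma plane_L2 w : L2R3 (plane w).
Proof.
split; first exact: measurable_plane.
rewrite normsq2_plane; exact: (integrable_lty).
Qed.

Lemma hnorm_plane w : hnorm H3 (plane w) = Num.sqrt normV.
Proof. by rewrite /hnorm hsq_normsq2 normsq2_plane. Qed.

Lemma measurable_green : measurable_funC setT green.
Proof.
have md : measurable_fun setT (fun p : R3 R * R3 R => norm3 (sub3 p.1 p.2)).
  by apply: measurable_norm3; exact: measurable_sub3.
apply: measurable_funCM; first apply: measurable_funCM.
- apply: measurable_funC_real; exact: (measurableT_comp measurable_sqrtV).
- apply: measurable_funCM; first by apply: measurable_cis; exact: measurable_funM.
  under eq_fun do rewrite -fmorphV.
  apply: measurable_funC_real; apply: measurable_inv_ge0 => // p.
  exact: sqrtr_ge0.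
- apply: measurable_funC_real; exact: (measurableT_comp measurable_sqrtV).
Qed.

(** The exponential has modulus one, so the squared modulus of the kernel is the Rollnik integrand
    itself. *)
Lemma green_L2 : L2 (mu3 \x mu3)%E setT green.
Proof.
split; first exact: measurable_green.
case: V_rollnik => _; apply: le_lt_trans; rewrite le_eqVlt; apply/orP; left; apply/eqP.
apply: eq_integral => p _; congr EFin.
rewrite !Normc.normcM normc_cis mul1r Normc.normcV !normc_real !exprMn exprVn.
by rewrite !real_normK ?num_real// !sqr_sqrtV mulrAC.
Qed.

Lemma green_sym p : green (p.2, p.1) = green p.
Proof. by rewrite /green /= norm3_subC; ring. Qed.

Lemma opK_green (f : E3) r : opK V l f r = inv4pi * hs_op mu3 green (mulW V f) r.
Proof. by []. Qed.

Lemma opK_L2 (f : E3) : L2R3 f -> L2R3 (opK V l f).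
Proof.
by move=> hf; exact: (L2Z measurableT inv4pi (hs_op_L2 green_L2 (mulW_L2 hf))).
Qed.

(** The [W] of the form falls on [g] and that of [K] on [f], which leaves the symmetric kernel
    [green] between [W f] and [W g]. *)
Lemma bil_opK (f g : E3) : L2R3 f -> L2R3 g -> bil (opK V l f) g = bil f (opK V l g).
Proof.
move=> hf hg; have Wf := mulW_L2 hf; have Wg := mulW_L2 hg.
have KWf := hs_op_L2 green_L2 Wf; have KWg := hs_op_L2 green_L2 Wg.
transitivity (inv4pi * integralC mu3 setT (fun r => hs_op mu3 green (mulW V f) r * mulW V g r)).
  rewrite -(integralCZ measurableT inv4pi (L2_mul measurableT KWf Wg)).
  by apply: eq_integralC => r _; rewrite /mulW opK_green; ring.
rewrite (hs_op_transpose green_L2 Wf Wg).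
rewrite (_ : (fun p => green (p.2, p.1)) = green); last by apply/funext => p; rewrite green_sym.
rewrite -(integralCZ measurableT inv4pi (L2_mul measurableT Wf KWg)).
by apply: eq_integralC => r _; rewrite opK_green; ring.
Qed.

Definition IK (f : E3) : E3 := f + (opK V l f : E3).

Lemma IK_L2 (f : E3) : L2R3 f -> L2R3 (IK f).
Proof. by move=> hf; exact: (@hdomD _ _ H3 _ _ hf (opK_L2 hf)). Qed.

Lemma bil_IK (f g : E3) : L2R3 f -> L2R3 g -> bil (IK f) g = bil f (IK g).
Proof.
move=> hf hg; have Kf := opK_L2 hf; have Kg := opK_L2 hg.
rewrite [RHS]bilC [LHS](bilDl hf Kf hg) [RHS](bilDl hg Kg hf).
by rewrite (bil_opK hf hg) [in RHS](bilC g) [in RHS](bilC (opK V l g)).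
Qed.

(** The whole kernel of [K], with [W] and the constant absorbed, so that the lower bound for
    Hilbert-Schmidt operators applies. *)
Let kW (p : R3 R * R3 R) : R[i] := inv4pi * (green p * (Num.sg (V p.2))%:C%C).

Let greenW_L2 : L2 (mu3 \x mu3)%E setT (fun p => green p * (Num.sg (V p.2))%:C%C).
Proof.
apply: (L2_le measurableT _ _ green_L2).
  apply: measurable_funCM; first exact: measurable_green.
  apply: measurable_funC_real; apply: measurable_sg.
  exact: (measurableT_comp mV).
by move=> p _; rewrite Normc.normcM ler_piMr ?normc_ge0// normc_sg.
Qed.

Let kW_L2 : L2 (mu3 \x mu3)%E setT kW.
Proof. exact: (L2Z measurableT inv4pi greenW_L2). Qed.

Let opK_kW (f : E3) : L2R3 f -> ae_eqC mu3 setT (opK V l f) (hs_op mu3 kW f).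
Proof.
move=> hf; apply: filterS (ae_row_L2 greenW_L2) => r hr _.
have e : hs_op mu3 green (mulW V f) r =
    integralC mu3 setT (fun s => green (r, s) * (Num.sg (V s))%:C%C * f s).
  by apply: eq_integralC => s _; rewrite mulrA.
rewrite opK_green e -(integralCZ measurableT inv4pi (L2_mul measurableT hr hf)).
by apply: eq_integralC => s _; rewrite /kW mulrA.
Qed.

Lemma IK_bounded_below : ~ exceptional V l ->
  exists2 c : R, 0 < c & forall f, L2R3 f -> c * hnorm H3 f <= hnorm H3 (IK f).
Proof.
move=> regular.
have IKk (f : E3) : L2R3 f -> ae_eqC mu3 setT (IK f) (f + (hs_op mu3 kW f : E3)).
  move=> hf; apply: filterS (opK_kW hf) => r hr Dr.
  by rewrite [LHS](_ : _ = f r + opK V l f r)// hr.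
have [|c c_gt0 hc] := @hs_op_bounded_below _ _ _ mu3 kW kW_L2.
  move=> f hf f0; apply: contrapT => fn0; apply: regular; split => //.
  exists f; split => //; apply: filterS2 f0 (IKk f hf) => r h1 h2 Dr.
  by rewrite -h1// -h2.
exists c => // f hf; apply: (le_trans (hc f hf)); rewrite le_eqVlt; apply/orP; left.
apply/eqP/esym/hnorm_ae; [exact: IK_L2| |exact: IKk].
exact: (@hdomD _ _ H3 _ _ hf (hs_op_L2 kW_L2 hf)).
Qed.

Lemma IKB (f g : E3) : L2R3 f -> L2R3 g -> ae_eqC mu3 setT (IK (f - g)) (IK f - IK g).
Proof.
move=> hf hg; have hfg : L2R3 (f - g) by exact: (@hdomB _ _ H3).
have e : f - g = -1 *: g + f by rewrite scaleN1r addrC.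
have hP := hs_opP kW_L2 (-1) hg hf; rewrite -e in hP.
apply: filterS (filterI (filterI (opK_kW hf) (opK_kW hg)) (filterI (opK_kW hfg) hP)).
move=> r [[h1 h2] [h3 h4]] Dr.
rewrite [LHS](_ : _ = (f r - g r) + opK V l (f - g) r)//.
rewrite [RHS](_ : _ = (f r + opK V l f r) - (g r + opK V l g r))//.
rewrite h1// h2// h3// h4//.
rewrite [X in _ + X = _](_ : _ = -1 * hs_op mu3 kW g r + hs_op mu3 kW f r)//; ring.
Qed.

(** For [delta = 1/(n+1)] the squared difference is at most [|V| min(4, (delta rho)^2)], whose
    integral tends to 0 by domination by [4 |V|]. Without the minimum, a second moment of [V] would
    be required. *)
Lemma plane_uniform (eps : R) : 0 < eps -> exists2 delta : R, 0 < delta &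
  forall w v, near3 delta w v -> hnorm H3 (plane w - plane v) <= eps.
Proof.
move=> eps0.
(* The sum norm is dual to the coordinatewise closeness of [near3]: the two phases at [r] differ by
   at most [delta * rho r]. *)
pose rho (r : R3 R) := Num.sqrt l * (`|crd1 r| + `|crd2 r| + `|crd3 r|).
pose h n r := (`|V r| * Num.min 4 ((n.+1%:R^-1 * rho r) ^+ 2))%:E.
have rho0 r : 0 <= rho r by rewrite /rho mulr_ge0 ?sqrtr_ge0// !addr_ge0.
have mid : measurable_fun setT (@id (R3 R)) by exact: measurable_id.
have mrho : measurable_fun setT rho.
  apply: measurable_funM => //; apply: measurable_funD; first apply: measurable_funD.
  - by apply: measurableT_comp => //; exact: measurable_crd1 mid.
  - by apply: measurableT_comp => //; exact: measurable_crd2 mid.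
  - by apply: measurableT_comp => //; exact: measurable_crd3 mid.
have mh n : measurable_fun setT (h n).
  apply/measurable_EFinP; apply: measurable_funM; first exact: measurableT_comp.
  apply: measurable_minr => //; apply: measurable_funX; exact: measurable_funM.
have hcv r : (h ^~ r) @ \oo --> 0%E.
  apply: cvg_EFin; first exact: nearW.
  rewrite /comp /= -[X in _ --> X](mulr0 `|V r|); apply: cvgM; first exact: cvg_cst.
  have cx : (fun n => (n.+1%:R^-1 * rho r) ^+ 2) @ \oo --> (0 : R).
    have c1 : (fun n => n.+1%:R^-1 * rho r) @ \oo --> (0 : R).
      rewrite -(mul0r (rho r)); apply: cvgM; last exact: cvg_cst.
      exact: cvg_harmonic.
    by rewrite -[X in _ --> X](mul0r 0); exact: (cvgM c1 c1).
  apply: (squeeze_cvgr _ (cvg_cst 0) cx); apply: nearW => n.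
  by rewrite ge_min lexx orbT andbT le_min sqr_ge0 ler0n.
have hb : {ae mu3, forall r n, setT r -> (`|h n r| <= 4%:E * `|V r|%:E)%E}.
  apply: aeW => r n _; rewrite gee0_abs /h; last first.
    by rewrite lee_fin mulr_ge0// le_min sqr_ge0 ler0n.
  by rewrite -EFinM lee_fin mulrC ler_wpM2r// ge_min lexx.
have [_ _] := @dominated_convergence _ _ _ mu3 setT measurableT h (fun=> 0%E)
  (fun r => 4%:E * `|V r|%:E)%E mh (measurable_cst _) (aeW _ (fun r _ => hcv r))
  (integrableZl measurableT 4 iV) hb.
rewrite integral0 => /fine_cvg/cvgrPdist_le/(_ (eps ^+ 2)).
rewrite exprn_gt0// => /(_ isT)[n _ hn].
exists n.+1%:R^-1; first by rewrite invr_gt0.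
move=> w v [[n1 n2] n3].
have hpp : L2R3 (plane w - plane v) by apply: (@hdomB _ _ H3); exact: plane_L2.
have hfin : (\int[mu3]_r h n r)%E \is a fin_num.
  apply: integrable_fin_num => //.
  apply: (le_integrable measurableT (mh n) _ (integrableZl measurableT 4 iV)) => r _.
  rewrite gee0_abs /h; last by rewrite lee_fin mulr_ge0// le_min sqr_ge0 ler0n.
  rewrite -EFinM gee0_abs ?lee_fin ?mulr_ge0//.
  by rewrite mulrC ler_wpM2r// ge_min lexx.
rewrite -(@ler_pXn2r _ 2)// ?nnegrE ?hnorm_ge0// ?(ltW eps0)// sqr_hnorm// hsq_normsq2.
have hint : fine (\int[mu3]_r h n r)%E <= eps ^+ 2.
  have := hn n (leqnn n); rewrite /= sub0r normrN; exact: le_trans (ler_norm _).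
apply: le_trans hint; rewrite -lee_fin (fineK hfin) fine_normsq2K//.
apply: ge0_le_integral => //.
- by move=> r _; rewrite lee_fin sqr_ge0.
- by apply/measurable_EFinP; apply: measurable_funC_normsq; case: hpp.
move=> r _; rewrite /h lee_fin.
rewrite [X in Normc.normc X](_ : _ = (sqrtV V r)%:C%C *
  (cis (Num.sqrt l * dot3 w r) - cis (Num.sqrt l * dot3 v r))); last by rewrite mulrBr.
rewrite Normc.normcM exprMn normc_real real_normK ?num_real// sqr_sqrtV ler_wpM2l//.
apply: le_trans (normc_cisB_le _ _) _.
rewrite le_min !ge_min lexx/=; apply/orP; right.
rewrite -mulrBr -[leLHS]real_normK ?num_real//.
rewrite ler_pXn2r ?nnegrE ?mulr_ge0//.
rewrite normrM (ger0_norm (sqrtr_ge0 _)) /rho mulrCA ler_wpM2l ?sqrtr_ge0//.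
have -> : dot3 w r - dot3 v r = (crd1 w - crd1 v) * crd1 r +
  (crd2 w - crd2 v) * crd2 r + (crd3 w - crd3 v) * crd3 r by rewrite /dot3; ring.
rewrite !mulrDr; apply: le_trans (ler_normD _ _) _; apply: lerD.
  apply: le_trans (ler_normD _ _) _.
  by apply: lerD; rewrite normrM ler_wpM2r.
by rewrite normrM ler_wpM2r.
Qed.

(** * Reciprocity, regularity of the amplitude and its action on eigenfunctions *)

Section amplitude.
Variable phi : R3 R -> R3 R -> R[i].
Hypothesis regular : ~ exceptional V l.
Hypothesis phi_LS : forall k : R3 R, norm3 k ^+ 2 = l ->
  lippmann_schwinger V k (fun r => phi r k).
Local Notation sigma := (@dOmega R).
Local Notation S2 := (@S2 R).
Local Notation L2S2 := (L2 sigma S2).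
Local Notation ampl w w' := (scattering_amplitude V phi w w' l).

Definition psi (w : R3 R) : E3 :=
  fun r => (sqrtV V r)%:C%C * phi r (scale3 (Num.sqrt l) w).

Lemma S2_norm3 w : S2 w -> norm3 (scale3 (Num.sqrt l) w) = Num.sqrt l.
Proof.
rewrite /Defs.S2 /= /norm3 => w1.
have d1 : dot3 w w = 1.
  have d0 : 0 <= dot3 w w by rewrite /dot3 -!expr2 !addr_ge0// sqr_ge0.
  by rewrite -[LHS]sqr_sqrtr// w1 expr1n.
rewrite dot3_scale dot3C dot3_scale d1 mulr1 -expr2.
by rewrite sqrtr_sqr ger0_norm// sqrtr_ge0.
Qed.

Lemma S2_opp w : S2 w -> S2 (opp3 w).
Proof.
rewrite /Defs.S2 /= /norm3 dot3_opp dot3C dot3_opp opprK.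
by [].
Qed.

Lemma psi_LS w : S2 w -> lippmann_schwinger V (scale3 (Num.sqrt l) w)
  (fun r => phi r (scale3 (Num.sqrt l) w)).
Proof. by move=> Sw; apply: phi_LS; rewrite S2_norm3// sqr_sqrtr// ltW. Qed.

Lemma psi_L2 w : S2 w -> L2R3 (psi w).
Proof. by move=> /psi_LS[]. Qed.

(** This is the Lippmann-Schwinger equation multiplied by [|V|^(1/2)], with [V] factored as
    [W |V|^(1/2) |V|^(1/2)] under the integral. *)
Lemma IK_psi w : S2 w -> ae_eqC mu3 setT (IK (psi w)) (plane w).
Proof.
move=> Sw; have hpsi := psi_L2 Sw; have [_ LS] := psi_LS Sw.
apply: filterS2 LS (ae_row_L2 green_L2) => r hr hrow Dr.
rewrite [LHS](_ : _ = psi w r + opK V l (psi w) r)//.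
rewrite {1}/psi hr// S2_norm3// dot3_scale -/inv4pi mulrBr -[RHS]addr0 -addrA; congr (_ + _).
apply/eqP; rewrite addrC subr_eq0; apply/eqP.
pose X s := cis (Num.sqrt l * norm3 (sub3 r s)) / (norm3 (sub3 r s))%:C%C
  * (V s)%:C%C * phi s (scale3 (Num.sqrt l) w).
rewrite -/(X _) opK_green mulrCA; congr (_ * _).
have eX s : (sqrtV V r)%:C%C * X s = green (r, s) * mulW V (psi w) s.
  by rewrite /X /green /mulW /psi -sg_sqrtV; ring.
have -> : hs_op mu3 green (mulW V (psi w)) r =
    integralC mu3 setT (fun s => (sqrtV V r)%:C%C * X s).
  by apply: eq_integralC => s _; rewrite eX.
(* Taking the factor out of the integral requires [X] integrable, which is known only of its product
   with [sqrtV V r]. Where the factor vanishes both sides are 0; elsewhere one divides by it. *)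
have [A0|A0] := eqVneq (sqrtV V r) 0.
  rewrite A0 mul0r; transitivity (integralC mu3 setT (fun=> 0)).
    by apply: eq_integralC => s _; rewrite mul0r.
  by rewrite /integralC/= !Rintegral_cst//= !mul0r.
rewrite integralCZ//.
have := integrableCZ measurableT ((sqrtV V r)^-1)%:C%C (L2_mul measurableT hrow (mulW_L2 hpsi)).
rewrite (_ : (fun s => _) = X)//; apply/funext => s.
rewrite -eX mulrA -rmorphM/= mulVf// mul1r.
by [].
Qed.

Lemma amplitudeE w w' : ampl w w' = - inv4pi * bil (plane (opp3 w)) (psi w').
Proof.
congr (_ * _); apply: eq_integralC => s _.
rewrite /mulW /plane /psi dot3_opp dot3C mulrN -sg_sqrtV; ring.
Qed.

Lemma reciprocity w w' : S2 w -> S2 w' ->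
  ampl w w' = - inv4pi * bil (psi (opp3 w)) (plane w').
Proof.
move=> /S2_opp Sw Sw'; rewrite amplitudeE; congr (_ * _).
have hw := psi_L2 Sw; have hw' := psi_L2 Sw'.
rewrite -(bil_ae (IK_L2 hw) (plane_L2 _) hw' (IK_psi Sw)) bil_IK//.
by rewrite bilC (bil_ae (IK_L2 hw') (plane_L2 _) hw (IK_psi Sw')) bilC.
Qed.

(** The lower bound on [I + K] transfers to [psi w] the norm of the plane waves and their continuity
    in [w]. *)
Lemma psi_bounds : exists2 C : R, 0 < C &
  (forall w, S2 w -> hnorm H3 (psi w) <= C) /\
  (forall w v, S2 w -> S2 v ->
     hnorm H3 (psi w - psi v) <= C * hnorm H3 (plane w - plane v)).
Proof.
have [c c_gt0 hc] := IK_bounded_below regular.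
pose N := Num.sqrt normV.
have N0 : 0 <= N by exact: sqrtr_ge0.
(* One constant for both claims: [N / c] serves the first and [1 / c] the second. *)
exists (c^-1 * (N + 1)); first by rewrite mulr_gt0 ?invr_gt0// ltr_wpDl.
split=> [w Sw|w v Sw Sv].
  have := hc _ (psi_L2 Sw); rewrite (hnorm_ae (IK_L2 (psi_L2 Sw)) (plane_L2 w) (IK_psi Sw)).
  rewrite hnorm_plane mulrC -ler_pdivlMr// => /le_trans; apply.
  by rewrite mulrC ler_wpM2l ?invr_ge0 ?(ltW c_gt0)// lerDl.
have hw := psi_L2 Sw; have hv := psi_L2 Sv.
have hwv : L2R3 (psi w - psi v) by exact: (@hdomB _ _ H3).
have pwv : L2R3 (plane w - plane v) by apply: (@hdomB _ _ H3); exact: plane_L2.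
have e : hnorm H3 (IK (psi w - psi v)) = hnorm H3 (plane w - plane v).
  apply: (hnorm_ae (IK_L2 hwv) pwv).
  apply: filterS (filterI (IKB hw hv) (filterI (IK_psi Sw) (IK_psi Sv))) => r [h1 [h2 h3]] Dr.
  rewrite h1// [LHS](_ : _ = IK (psi w) r - IK (psi v) r)// h2// h3//.
have := hc _ hwv; rewrite e mulrC -ler_pdivlMr// => /le_trans; apply.
rewrite mulrC; apply: ler_wpM2r; first exact: hnorm_ge0.
by rewrite ler_peMr ?invr_ge0 ?(ltW c_gt0)// lerDr.
Qed.

Lemma amplitude_bounded : exists M : R, forall w w', S2 w -> S2 w' ->
  Normc.normc (ampl w w') ^+ 2 <= M.
Proof.
have [C C0 [hC _]] := psi_bounds.
exists ((Normc.normc inv4pi * (Num.sqrt normV * C)) ^+ 2) => w w' Sw Sw'.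
have B0 : 0 <= Normc.normc inv4pi * (Num.sqrt normV * C).
  by rewrite mulr_ge0 ?normc_ge0// mulr_ge0 ?sqrtr_ge0// ltW.
rewrite ler_pXn2r ?nnegrE ?normc_ge0//.
rewrite amplitudeE Normc.normcM normcN ler_wpM2l ?normc_ge0//.
apply: le_trans (bil_bound (plane_L2 _) (psi_L2 Sw')) _.
by rewrite hnorm_plane ler_wpM2l ?sqrtr_ge0// hC.
Qed.

Lemma near3_opp delta w v : near3 delta w v -> near3 delta (opp3 w) (opp3 v).
Proof.
by rewrite /near3 /opp3 /= => -[[h1 h2] h3];
  rewrite /crd1 /crd2 /crd3 !mulN1r -!opprD !normrN.
Qed.

Lemma amplitude_uniform (eps : R) : 0 < eps -> exists2 delta : R, 0 < delta &
  forall w w' v v', S2 w -> S2 w' -> S2 v -> S2 v' ->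
    near3 delta w v -> near3 delta w' v' ->
    Normc.normc (ampl w w' - ampl v v') <= eps.
Proof.
move=> eps0; have [C C0 [hC hCB]] := psi_bounds.
pose N := Num.sqrt normV; have N0 : 0 <= N by exact: sqrtr_ge0.
(* By bilinearity the difference splits into a variation of the plane wave, costing a factor [C],
   and one of [psi], costing [C * N]. The 1 added to the modulus of [inv4pi] keeps [K] visibly
   positive. *)
pose K := (Normc.normc inv4pi + 1) * (C * (N + 1)).
have K0 : 0 < K by rewrite !mulr_gt0// ltr_wpDl// normc_ge0.
have e2 : 0 < eps / (2 * K) by rewrite divr_gt0// mulr_gt0.
have [delta d0 hd] := plane_uniform e2.
exists delta => // w w' v v' Sw Sw' Sv Sv' n1 n2.
have dw := hd _ _ (near3_opp n1); have dw' := hd _ _ n2.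
have hw' := psi_L2 Sw'; have hv' := psi_L2 Sv'.
have P (x : R3 R) := plane_L2 x.
have hp : L2R3 (plane (opp3 w) - plane (opp3 v)) by exact: (@hdomB _ _ H3 _ _ (P _) (P _)).
have hpsi : L2R3 (psi w' - psi v') by exact: (@hdomB _ _ H3 _ _ hw' hv').
have e : ampl w w' - ampl v v' = - inv4pi *
    (bil (plane (opp3 w) - plane (opp3 v)) (psi w') + bil (psi w' - psi v') (plane (opp3 v))).
  have hN (f : E3) : L2R3 f -> L2R3 (- f) by exact: (@hdomN _ _ H3).
  rewrite !amplitudeE (bilDl (P _) (hN _ (P _)) hw') (bilDl hw' (hN _ hv') (P _)).
  rewrite (bilNl (P _) hw') (bilNl hv' (P _)) (bilC (psi w')) (bilC (psi v')).
  ring.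
rewrite e Normc.normcM normcN.
have b1 : Normc.normc (bil (plane (opp3 w) - plane (opp3 v)) (psi w')) <= eps / (2 * K) * C.
  apply: le_trans (bil_bound hp hw') _.
  by apply: ler_pM => //; rewrite ?hnorm_ge0// hC.
have b2 : Normc.normc (bil (psi w' - psi v') (plane (opp3 v))) <= C * (eps / (2 * K)) * N.
  apply: le_trans (bil_bound hpsi (P _)) _; rewrite hnorm_plane ler_wpM2r//.
  apply: le_trans (hCB _ _ Sw' Sv') _; by rewrite ler_wpM2l ?(ltW C0).
apply: (@le_trans _ _ ((Normc.normc inv4pi + 1) * (eps / (2 * K) * C * (N + 1)))).
  apply: ler_pM; rewrite ?normc_ge0// ?lerDl//.
  apply: le_trans (le_normcD _ _) _; apply: le_trans (lerD b1 b2) _.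
  by rewrite mulrDr mulr1 addrC (mulrC C).
have -> : (Normc.normc inv4pi + 1) * (eps / (2 * K) * C * (N + 1)) = eps / 2.
  have -> : (Normc.normc inv4pi + 1) * (eps / (2 * K) * C * (N + 1)) = eps / (2 * K) * K.
    by rewrite /K; ring.
  by field; rewrite gt_eqF.
by rewrite ler_pdivrMr// ler_pMr// ler1n.
Qed.

Lemma amplitude_measurable : measurable_funC (S2 `*` S2) (fun p => ampl p.1 p.2).
Proof.
have mSS : measurable (S2 `*` S2) by apply: measurableX; exact: measurable_S2.
have cover := small_cover_prod (@small_cover_near3 R) (@small_cover_near3 R).
split; apply: (uniformly_continuous_measurable cover mSS) => eps /amplitude_uniform[delta d0 hd];
  exists delta => // p q [Sp1 Sp2] [Sq1 Sq2] [n1 n2];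
  apply: le_trans (hd _ _ _ _ Sp1 Sp2 Sq1 Sq2 n1 n2).
  by rewrite -cReN -cReD ler_Re_normc.
by rewrite -cImN -cImD ler_Im_normc.
Qed.

Definition opF_const : R := 4^-1 * l `^ (4^-1) * pi `^ (- (3 / 2)).

Lemma opF_bil (f : E3) w : opF V l (mulW V f) w = opF_const%:C%C * bil f (plane (opp3 w)).
Proof.
congr (_ * _); apply: eq_integralC => r _.
by rewrite /mulW /plane dot3_opp mulrN; ring.
Qed.

Lemma sqr_opF_const : opF_const ^+ 2 = Num.sqrt l / (16 * pi ^+ 3).
Proof.
have p0 : 0 < pi :> R by exact: pi_gt0.
rewrite /opF_const !exprMn -![_ `^ _ ^+ 2]powR_mulrn ?powR_ge0// -!powRrM.
have -> : 4^-1 * 2 = 2^-1 :> R by field.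
have -> : - (3 / 2) * 2 = - (3%:R) :> R by field.
rewrite powR12_sqrt ?(ltW l_gt0)// powRN powR_mulrn ?(ltW p0)//.
have -> : 4^-1 ^+ 2 = 16^-1 :> R by field.
by rewrite [in RHS]invfM [16^-1 * _]mulrC -mulrA.
Qed.

Lemma amplitude_eigen (mu : R[i]) (g : R3 R -> R[i]) : L2S2 g ->
  scattering_graph V l g (fun w => mu * g w) ->
  {ae sigma, forall w, S2 w ->
    integralC sigma S2 (fun w' => ampl w w' * g w') =
    (Complex (2 * pi) 0 / Complex 0 (Num.sqrt l)) * (mu - 1) * g w}.
Proof.
move=> hg [t [u [chi [[_ hu adj] [_ hchi chi_eq] t_eq]]] g_eq].
have mS2 := @measurable_S2 R.
apply: filterS2 t_eq g_eq => w ht hg' Sw.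
have Sow := S2_opp Sw; have hpo := psi_L2 Sow.
(* The test function for the adjoint relation; conjugating reciprocity shows that its image under
   [F] is a multiple of the conjugate of [f(w, .)]. *)
pose h : E3 := mulW V (fun r => (psi (opp3 w) r)^*%C).
have hpJ : L2R3 (fun r => (psi (opp3 w) r)^*%C) by exact: L2J.
have hh : L2R3 h by exact: mulW_L2.
have WJ (f : E3) r : mulW V (fun r => (f r)^*%C) r = (mulW V f r)^*%C.
  by rewrite /mulW conjcM conjc_real.
have Fh w' : S2 w' -> opF V l h w' = - (4 * pi * opF_const)%:C%C * (ampl w w')^*%C.
  move=> Sw'; rewrite opF_bil reciprocity//.
  have -> : bil (fun r => (psi (opp3 w) r)^*%C) (plane (opp3 w')) =
      (bil (psi (opp3 w)) (plane w'))^*%C.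
    rewrite -(integralCJ measurableT (L2_mul measurableT (mulW_L2 hpo) (plane_L2 w'))).
    apply: eq_integralC => r _; rewrite WJ [in RHS]conjcM; congr (_ * _).
    by rewrite /plane dot3_opp mulrN cisN conjcM conjc_real.
  rewrite conjcM conjcN /inv4pi conjc_real mulrA; congr (_ * _).
  rewrite mulrNN -rmorphM/=; congr (_%:C%C).
  by rewrite mulrAC divff ?mul1r// mulf_neq0// gt_eqF// pi_gt0.
have [M hM] := amplitude_bounded.
have hampl : L2S2 (fun w' => ampl w w').
  have mrow := measurable_funC_row mS2 Sw amplitude_measurable.
  exact: (proj1 (@bounded_L2 R _ _ sigma S2 mS2 (fun w' => ampl w w') M mrow (fun w' Sw' => hM w w' Sw Sw'))).
have := adj _ hh.
have -> : inner2 sigma S2 (opF V l h) g =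
    (- (4 * pi * opF_const)%:C%C * integralC sigma S2 (fun w' => ampl w w' * g w'))^*%C.
  have I2 := L2_mul mS2 hampl hg.
  rewrite -(integralCZ mS2 (- (4 * pi * opF_const)%:C%C) I2).
  rewrite -(integralCJ mS2 (integrableCZ mS2 (- (4 * pi * opF_const)%:C%C) I2)).
  have cJ (x : R) (a b : R[i]) :
      (- x%:C%C * (a * b))^*%C = - x%:C%C * a^*%C * b^*%C.
    by rewrite !conjcM conjcN conjc_real mulrA.
  by apply: eq_integralC => w' Sw'; rewrite Fh// cJ.
have -> : inner2 mu3 setT h u = (bil (psi (opp3 w)) u)^*%C.
  rewrite -(integralCJ measurableT (L2_mul measurableT (mulW_L2 hpo) hu)).
  by apply: eq_integralC => r _; rewrite /h WJ [in RHS]conjcM.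
(* Since [u] is [(I + K) chi], the symmetry of [I + K] moves the operator onto [psi_(-w)], where it
   yields the plane wave. *)
have -> : bil (psi (opp3 w)) u = bil chi (plane (opp3 w)).
  exact: etrans (bilC _ _) (etrans (esym (bil_ae (IK_L2 hchi) hu hpo chi_eq))
    (etrans (bil_IK hchi hpo) (etrans (bilC _ _)
    (etrans (bil_ae (IK_L2 hpo) (plane_L2 _) hchi (IK_psi Sow)) (bilC _ _))))).
move=> /(can_inj (@conjcK R)) key.
have {}ht : t w = opF_const%:C%C * bil chi (plane (opp3 w)) by rewrite ht// opF_bil.
have {}hg' := hg' Sw.
rewrite ht -key in hg'.
set I := integralC _ _ _ in hg' *.
have sl0 : Num.sqrt l != 0 by rewrite gt_eqF// sqrtr_gt0.
have a0 : Complex 0 (Num.sqrt l) != 0 :> R[i] by rewrite eq_complex/= (negbTE sl0) andbF.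
(* With [p = pi] and [c] the prefactor of [F], the right side becomes [i sqrt l] by [sqr_opF_const].
   One [c] comes from [F] in [T], the other from the adjoint relation, and [4 pi] from the
   normalisation of the amplitude. *)
have cst (p c : R) : Complex (2 * p) 0 * (Complex 0 (2 * p) * (c%:C%C * (4 * p * c)%:C%C)) =
    Complex 0 (c ^+ 2 * (16 * p ^+ 3)) :> R[i].
  by apply: complexP => /=; ring.
have {}cst := cst pi opF_const; rewrite sqr_opF_const divfK in cst; last first.
  by rewrite mulf_neq0// expf_neq0// gt_eqF// pi_gt0.
have e : (mu - 1) * g w = Complex 0 (2 * pi) * (opF_const%:C%C * (4 * pi * opF_const)%:C%C) * I.
  by rewrite mulrBl mul1r hg'; ring.
have solve (A B K J m z : R[i]) : B != 0 -> A * K = B -> m * z = K * J -> J = A / B * m * z.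
  by move=> B0 AK mz; rewrite -mulrA mz mulrA [A / B * K]mulrAC AK divff// mul1r.
exact: solve a0 cst e.
Qed.

End amplitude.
End potential.

Theorem theorem8p8 (R : realType) (V : R3 R -> R)
  (V_rollnik : rollnik V)
  (V_L1 : V \in Lfun (@leb3 R) 1%E)
  (V_L2 : V \in Lfun (@leb3 R) 2%:E)
  (V_decay : exists2 delta : R, 0 < delta & bigO_at_infinity V (- 3 - delta))
  (lambda : R) (lambda_regular : regular_energies V lambda)
  (phi : R3 R -> R3 R -> R[i])
  (phi_LS : forall k : R3 R, norm3 k ^+ 2 = lambda ->
     lippmann_schwinger V k (fun r => phi r k))
  (G : nat -> R3 R -> R[i]) (mu : nat -> R[i])
  (G_complete : complete_orthonormal (@dOmega R) (@S2 R) G)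
  (G_eigen : forall j : nat,
     scattering_graph V lambda (G j) (fun w => mu j * G j w))
  (mu_unit : forall j : nat, `|mu j| = 1) :
  L2 (@dOmega R \x @dOmega R)%E (@S2 R `*` @S2 R)
     (fun p => scattering_amplitude V phi p.1 p.2 lambda) /\
  (fun n : nat =>
     normsq2 (@dOmega R \x @dOmega R)%E (@S2 R `*` @S2 R)
       (fun p => scattering_amplitude V phi p.1 p.2 lambda -
          (Complex (2 * pi) 0 / Complex 0 (Num.sqrt lambda)) *
          \sum_(j < n) (mu j - 1) * G j p.1 * ((G j p.2)^*)%C)) @ \oo
    --> 0%E.
Proof.
case: lambda_regular => l_gt0 regular.
pose c : R[i] := Complex (2 * pi) 0 / Complex 0 (Num.sqrt lambda).
have mS2 := @measurable_S2 R.
have mF := amplitude_measurable V_rollnik V_L1 l_gt0 regular phi_LS.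
have [M hM] := amplitude_bounded V_rollnik V_L1 l_gt0 regular phi_LS.
have FM (p : R3 R * R3 R) : (@S2 R `*` @S2 R) p ->
    Normc.normc (scattering_amplitude V phi p.1 p.2 lambda) ^+ 2 <= M.
  by move=> [Sw Sw']; exact: hM.
have [[GL2 _] _] := G_complete.
have eig j : {ae @dOmega R, forall w, @S2 R w ->
    integralC (@dOmega R) (@S2 R)
      (fun w' => scattering_amplitude V phi w w' lambda * G j w') =
    c * (mu j - 1) * G j w}.
  exact: amplitude_eigen (GL2 j) (G_eigen j).
split; first exact: (@kernel_L2 R _ _ (@dOmega R) (@S2 R) mS2 _ M mF FM).
have := @kernel_expansion R _ _ (@dOmega R) (@S2 R) mS2 _ M G _ mF FM G_complete eig.
rewrite (_ : (fun n => normsq2 _ _ _) = (fun n : nat =>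
  normsq2 (@dOmega R \x @dOmega R)%E (@S2 R `*` @S2 R)
    (fun p => scattering_amplitude V phi p.1 p.2 lambda -
      c * \sum_(j < n) (mu j - 1) * G j p.1 * ((G j p.2)^*)%C)))//.
apply/funext => n; congr normsq2; apply/funext => p; congr (_ - _).
by rewrite mulr_sumr; apply: eq_bigr => j _; rewrite !mulrA.
Qed.
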